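(* Suppose $f$ is a unit vector in $F^2$ and $\theta_{\pm}$ are the angles between $f$ and $f'\pm zf$ in $F^2$. Then for any $\sigma>0$, $$\left(\frac\sigma2\|f'+zf\|^2+\frac1{2\sigma}\|f'-zf\|^2\right)|\sin(\theta_+)\sin(\theta_-)|\ge1,$$ with equality if and only if $\|f'-zf\|=\sigma\|f'+zf\|$ and $f$ satisfies, for some positive constant $c$, the integral-differential equation $$f'+zf-\langle f'+zf,f\rangle f=-c\left[f'-zf-\langle f'-zf,f\rangle f\right].$$ In particular, $$(\|f'\|^2+\|zf\|^2)\,|\sin(\theta_+)\sin(\theta_-)|\ge1,$$ with equality if and only if $\|f'+zf\|=\|f'-zf\|$ and $f$ satisfies, for some positive constant $c$, the same integral-differential equation $f'+zf-\langle f'+zf,f\rangle f=-c\left[f'-zf-\langle f'-zf,f\rangle f\right]$.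
   Context: The Fock space is $F^2=L^2(\mathbb{C},d\lambda)\cap H(\mathbb{C})$, where $H(\mathbb{C})$ is the space of entire functions and $d\lambda(z)=\frac1\pi e^{-|z|^2}dA(z)$ with $dA$ ordinary area measure. It is a Hilbert space with $\langle f,g\rangle=\int_{\mathbb{C}} f\overline{g}\,d\lambda$ and $\|f\|^2=\int_{\mathbb{C}}|f|^2\,d\lambda$. Here $f'$ is the complex derivative and $zf$ denotes the function $z\mapsto zf(z)$. The angle $\theta$ between nonzero $f,g\in F^2$ is $\theta\in[0,\pi/2]$ with $\cos\theta=\frac{|\langle g,f\rangle|}{\|g\|\,\|f\|}$. When $f'\notin F^2$ (equivalently $zf\notin F^2$) the left-hand sides of the inequalities are regarded as $+\infty$, so the inequalities are trivially true (and strict); the equality conditions are understood to include $f'\in F^2$, so that the inner products and norms in them are defined. *)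

(* Defs.v *)
From HB Require Import structures.
From mathcomp Require Import all_boot all_order all_algebra.
From mathcomp Require Import complex.
From mathcomp Require Import all_classical all_reals all_analysis.

Set Implicit Arguments.
Unset Strict Implicit.
Unset Printing Implicit Defensive.

Import Order.TTheory GRing.Theory Num.Theory.
Import numFieldNormedType.Exports.
Import ComplexField.Normc.

Local Open Scope classical_set_scope.
Local Open Scope ring_scope.

Section FockSpace.
Context {R : realType}.
Implicit Types (f g : R[i] -> R[i]) (u : R[i] -> R) (z : R[i]) (p : R * R).

(* R[i]^o is R[i] viewed as a normed space over itself, so both notions below
   are complex differentiation, with complex increments h -> 0. *)
Definition entire f : Prop :=
  forall z, derivable (f : R[i]^o -> R[i]^o) z 1.

Definition cderiv f : R[i] -> R[i] := derive1 (f : R[i] -> R[i]^o).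

Definition area_measure := (@lebesgue_measure R \x @lebesgue_measure R)%E.

(* u(x + iy) e^{-|x + iy|^2} / pi, so that the integral of u against
   d lambda = e^{-|z|^2} dA / pi is the area integral of gauss_weighted u. *)
Definition gauss_weighted u p : R :=
  let z := Complex p.1 p.2 in u z * (expR (- (normc z ^+ 2)) / pi).

Definition lambda_integrable u : Prop :=
  area_measure.-integrable [set: R * R] (EFin \o gauss_weighted u).

Definition lambda_int u : R :=
  Rintegral area_measure [set: R * R] (gauss_weighted u).

(* An entire function is continuous, so square integrability needs no
   separate measurability clause for f. *)
Definition in_fock f : Prop :=
  entire f /\ lambda_integrable (fun z => normc (f z) ^+ 2).

Definition fock_dot f g : R[i] :=
  Complex (lambda_int (fun z => complex.Re (f z * conjc (g z))))
          (lambda_int (fun z => complex.Im (f z * conjc (g z)))).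

Definition fock_norm f : R :=
  Num.sqrt (lambda_int (fun z => normc (f z) ^+ 2)).

(* For nonzero f, g in the Fock space the quotient lies in [0, 1], where acos
   takes values in [0, pi/2]. *)
Definition fock_angle f g : R :=
  acos (normc (fock_dot g f) / (fock_norm g * fock_norm f)).

Definition zmul f : R[i] -> R[i] := fun z => z * f z.

Definition dplus f : R[i] -> R[i] := cderiv f \+ zmul f.
Definition dminus f : R[i] -> R[i] := cderiv f \- zmul f.

(* A left-hand side x involving f' is regarded as +oo when f' is not in the
   Fock space. *)
Definition fock_lhs f (x : R) : \bar R :=
  if `[< in_fock (cderiv f) >] then x%:E else +oo%E.

Definition intdiff_eq f (c : R) : Prop :=
  forall z, dplus f z - fock_dot (dplus f) f * f z
          = - (real_complex R c * (dminus f z - fock_dot (dminus f) f * f z)).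

End FockSpace.

(* Main.v *)
Require Import Defs.
From HB Require Import structures.
From mathcomp Require Import all_boot all_order all_algebra.
From mathcomp Require Import complex.
From mathcomp Require Import all_classical all_reals all_analysis.
From mathcomp Require Import measurable_realfun ring lra.
Import Order.TTheory GRing.Theory Num.Theory.
Import numFieldNormedType.Exports.
Local Open Scope classical_set_scope.
Local Open Scope ring_scope.

(** Let D f = f' and let Z be multiplication by the coordinate z. On the Fock
    space these operators are adjoint to each other and satisfy the commutation
    relation DZ - ZD = 1. Hence for a unit vector f the number <f' + z f, f> is
    real and <f' - z f, f> is imaginary. Let u and v be the components of
    f' + z f and f' - z f orthogonal to f. Then
    [Re <u, v> = Re <f' + z f, f' - z f> = |f'|^2 - |z f|^2 = - |f|^2 = -1]
    ([re_fock_dot_reject]), and Cauchy-Schwarz gives [1 <= |u| |v|], with equality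
    exactly when u = - c v for some c > 0 ([fock_norm_mul_ge1] and
    [fock_norm_mul_eq1]), which is the integral-differential equation. Now |u| and
    |v| are the norms of f' + z f and f' - z f times the sines of their angles with
    f ([fock_norm_sin_angle]), and the inequality between the arithmetic and the
    geometric mean introduces sigma. The second inequality is the case sigma = 1,
    by the parallelogram identity.

    The analytic content is that if f and f' belong to the Fock space then so does
    z f, with [<f', f> = <f, z f>] and [|z f|^2 = |f|^2 + |f'|^2]. All three facts
    are integrations by parts against the Gaussian weight, that is, instances of
    the divergence theorem for a vector field (P, Q) multiplied by
    [k (|z|^2) e^(-|z|^2) / pi], where k is a compactly supported cutoff
    ([gint_divergence]). The fields P + i Q are
    - [z |f|^2], which bounds the cut off integrals of [|z f|^2] uniformly, so that
      z f is square integrable ([gintegrable_rho_sqmod]), and which then yields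
      [|z f|^2 = |f|^2 + Re <z f', f>] ([gint_euler]);
    - [|f|^2] and [i |f|^2], which yield the adjunction ([gint_gradient_x], [gint_gradient_y]);
    - [f conj (f')], which yields [Re <z f', f> = |f'|^2] ([gint_dbar]); here
      the derivative f' is replaced by difference quotients of f, because its own
      derivative is not known to be continuous.
    With the integrability of [|z f|^2] at hand, the cutoff is removed by dominated
    convergence ([gint_limit]). *)


(** * Complex differentiation in real coordinates *)

Section complex_to_real.
Context {R : realType}.
Implicit Types (z w : R[i]).

Lemma normc_sqr z :
  ComplexField.Normc.normc z ^+ 2 = complex.Re z ^+ 2 + complex.Im z ^+ 2.
Proof. by case: z => a b /=; rewrite sqr_sqrtr ?addr_ge0 ?sqr_ge0. Qed.

Lemma nbhs_dist_lt z (e : R) : 0 < e ->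
  \forall t \near (z : R[i]^o), `|z - t| < e%:C%C.
Proof.
move=> e0; have e0' : 0 < (e%:C%C : R[i]) by rewrite ltcR.
have zb : nbhs (z : R[i]^o) (ball (z : R[i]^o) (e%:C%C : R[i])).
  exact: nbhsx_ballx.
by near=> t; have : ball (z : R[i]^o) (e%:C%C : R[i]) t; [near: t|].
Unshelve. all: by end_near.
Qed.

Lemma continuous_Re : continuous (fun z : R[i]^o => complex.Re z : R).
Proof.
move=> z; have FF := nbhs_filter (z : R[i]^o).
apply/(@cvgrPdist_lt _ _ _ _ FF) => e e0.
near=> t; have zt : `|z - t| < e%:C%C by near: t; exact: nbhs_dist_lt.
rewrite -ltcR (_ : complex.Re z - complex.Re t = complex.Re (z - t)); last first.
  by case: (z) (t) => ? ? [].
exact: le_lt_trans (normc_ge_Re _) zt.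
Unshelve. all: by end_near. Qed.

Lemma continuous_Im : continuous (fun z : R[i]^o => complex.Im z : R).
Proof.
move=> z; have FF := nbhs_filter (z : R[i]^o).
apply/(@cvgrPdist_lt _ _ _ _ FF) => e e0.
near=> t; have zt : `|z - t| < e%:C%C by near: t; exact: nbhs_dist_lt.
rewrite -ltcR (_ : complex.Im z - complex.Im t = complex.Im (z - t)); last first.
  by case: (z) (t) => ? ? [].
apply: le_lt_trans zt.
have -> : complex.Im (z - t) = complex.Re (- 'i%C * (z - t)).
  by case: (z - t) => a b; simpc.
apply: le_trans (normc_ge_Re _) _; rewrite normrM normrN.
by rewrite [X in X * _]normc_def /= expr0n expr1n add0r sqrtr1 mul1r.
Unshelve. all: by end_near. Qed.

Lemma normc_le_ReIm z :
  `|z| <= (`|complex.Re z| + `|complex.Im z|)%:C%C.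
Proof.
rewrite normc_def lecR -[leRHS]ger0_norm ?addr_ge0// -[leRHS]sqrtr_sqr.
apply: ler_wsqrtr; rewrite sqrrD !real_normK ?num_real//.
by rewrite -addrA [X in _ <= _ + X]addrC addrA lerDl mulrn_wge0// mulr_ge0.
Qed.

Lemma cvg_complex T (F : set_system T) {FF : Filter F} (a b : T -> R) (l m : R) :
  a @ F --> l -> b @ F --> m ->
  (fun x => (a x +i* b x)%C) @ F --> ((l +i* m)%C : R[i]^o).
Proof.
move=> al bm; apply/(@cvgrPdist_lt _ (R[i]^o)) => -[e e'] /= /andP[/eqP -> e0].
have e2 : 0 < e / 2 by rewrite divr_gt0.
near=> x; rewrite -/((e)%:C%C).
apply: le_lt_trans (normc_le_ReIm _) _ => /=.
rewrite ltcR [ltRHS]splitr; apply: ltrD; near: x.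
  by move/cvgrPdist_lt: al; exact.
by move/cvgrPdist_lt: bm; exact.
Unshelve. all: by end_near. Qed.

Definition pt (p : R * R) : R[i] := (p.1 +i* p.2)%C.

Lemma continuous_pt : continuous (pt : R * R -> R[i]^o).
Proof. by move=> p; apply: cvg_complex; [exact: cvg_fst|exact: cvg_snd]. Qed.

Lemma entire_continuous {f : R[i] -> R[i]} :
  entire f -> continuous (f : R[i]^o -> R[i]^o).
Proof.
move=> fe z; apply: differentiable_continuous.
by apply/derivable1_diffP; exact: fe.
Qed.

(** The real increment [h] runs along the complex direction [w]; the four partial
    derivatives of the real and imaginary parts are the cases [w = 1] and
    [w = i], so that the Cauchy-Riemann equations are built into them. *)
Lemma entire_dirderiv {f : R[i] -> R[i]} z {w} : entire f -> w != 0 ->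
  (fun h : R => (h^-1)%:C%C * (f (h%:C%C * w + z) - f z)) @ 0^' -->
    (w * cderiv f z : R[i]^o).
Proof.
move=> fe w0.
have cv : (fun h : R[i]^o => h^-1 * (f (h + z) - f z)) @ (0 : R[i]^o)^' -->
    (cderiv f z : R[i]^o).
  have := fe z; rewrite /derivable /cderiv /derive1.
  suff -> : (fun h : R[i]^o => h^-1 *: ((f \o shift z) (h *: 1) - f z)) =
    (fun h : R[i]^o => h^-1 *: ((f (h + z) : R[i]^o) - f z)) by [].
  by apply/funext => h; rewrite /= /shift /= /GRing.scale /= mulr1.
have hw : (fun h : R => h%:C%C * w) @ 0^' --> (0 : R[i]^o)^'.
  have h0 : (fun h : R => h%:C%C * w) @ 0^' --> (0 : R[i]^o).
    have -> : (fun h : R => h%:C%C * w) =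
        (fun h : R => Complex (h * complex.Re w) (h * complex.Im w)).
      by apply/funext => h; case: w {w0} => a b; simpc.
    have -> : (0 : R[i]^o) = Complex (0 * complex.Re w) (0 * complex.Im w).
      by rewrite !mul0r.
    have i0 : (fun h : R => h) @ 0^' --> (0 : R) by exact: nbhs_dnbhs.
    by apply: cvg_complex; exact: cvgMr_tmp.
  move=> A /h0 /=; rewrite /nbhs /= => A0; near=> h.
  have /= : (h%:C%C * w != 0 -> A (h%:C%C * w)) by near: h.
  apply; rewrite mulf_neq0// fmorph_eq0.
  by near: h; exact: nbhs_dnbhs_neq.
have := @cvgMl_tmp R[i] _ _ _ _ w _ (@cvg_comp _ _ _ _ _ _ _ _ hw cv).
move=> /(_ _) cwv; refine (cvg_trans _ cwv); apply: near_eq_cvg; near=> h.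
have h0 : h%:C%C != 0 :> R[i].
  by rewrite fmorph_eq0; near: h; exact: nbhs_dnbhs_neq.
by rewrite /= mulrA invfM mulrCA mulfV// mulr1 fmorphV.
Unshelve. all: by end_near. Qed.

Lemma is_derive_cvg (g : R -> R) x l :
  (fun h => h^-1 * (g (h + x) - g x)) @ 0^' --> l -> is_derive x (1 : R) g l.
Proof.
have E : (fun h : R => h^-1 * (g (h + x) - g x)) =
    (fun h => h^-1 *: ((g \o shift x) (h *: 1) - g x)).
  by apply/funext => h; rewrite /= /shift /= /GRing.scale /= mulr1.
rewrite E => gl; apply: DeriveDef; first exact: cvgP gl.
by apply: cvg_lim gl; exact: Rhausdorff.
Qed.

Section partials.
Context {f : R[i] -> R[i]}.
Hypothesis fe : entire f.
Let f' := cderiv f.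

Lemma entire_is_derive_Rex x y :
  is_derive x (1 : R) (fun t => complex.Re (f (pt (t, y))))
     (complex.Re (f' (pt (x, y)))).
Proof.
apply: is_derive_cvg.
have := @cvg_comp _ _ _ _ _ _ _ _
  (entire_dirderiv (pt (x, y)) fe (oner_neq0 _))
  (@continuous_Re (1 * f' (pt (x, y)))).
rewrite mul1r /comp /= => H; refine (cvg_trans _ H).
apply: near_eq_cvg; near=> h; rewrite /pt /=.
have -> : h%:C%C * 1 + (x +i* y)%C = ((h + x) +i* y)%C by simpc.
case: (f _) => a b; case: (f _) => c d; by simpc.
Unshelve. all: by end_near. Qed.

Lemma entire_is_derive_Imx x y :
  is_derive x (1 : R) (fun t => complex.Im (f (pt (t, y))))
     (complex.Im (f' (pt (x, y)))).
Proof.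
apply: is_derive_cvg.
have := @cvg_comp _ _ _ _ _ _ _ _
  (entire_dirderiv (pt (x, y)) fe (oner_neq0 _))
  (@continuous_Im (1 * f' (pt (x, y)))).
rewrite mul1r /comp /= => H; refine (cvg_trans _ H).
apply: near_eq_cvg; near=> h; rewrite /pt /=.
have -> : h%:C%C * 1 + (x +i* y)%C = ((h + x) +i* y)%C by simpc.
case: (f _) => a b; case: (f _) => c d; by simpc.
Unshelve. all: by end_near. Qed.

Let i0 : 'i%C != 0 :> R[i].
Proof. by rewrite eq_complex /= oner_eq0 andbF. Qed.

Lemma entire_is_derive_Rey x y :
  is_derive y (1 : R) (fun t => complex.Re (f (pt (x, t))))
     (- complex.Im (f' (pt (x, y)))).
Proof.
apply: is_derive_cvg.
have := @cvg_comp _ _ _ _ _ _ _ _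
  (entire_dirderiv (pt (x, y)) fe i0)
  (@continuous_Re ('i%C * f' (pt (x, y)))).
have -> : complex.Re ('i%C * f' (pt (x, y))) = - complex.Im (f' (pt (x, y))).
  by case: (f' _) => a b; simpc.
rewrite /comp /= => H; refine (cvg_trans _ H).
apply: near_eq_cvg; near=> h; rewrite /pt /=.
have -> : h%:C%C * 'i%C + (x +i* y)%C = (x +i* (h + y))%C by simpc.
case: (f _) => a b; case: (f _) => c d; by simpc.
Unshelve. all: by end_near. Qed.

Lemma entire_is_derive_Imy x y :
  is_derive y (1 : R) (fun t => complex.Im (f (pt (x, t))))
     (complex.Re (f' (pt (x, y)))).
Proof.
apply: is_derive_cvg.
have := @cvg_comp _ _ _ _ _ _ _ _
  (entire_dirderiv (pt (x, y)) fe i0)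
  (@continuous_Im ('i%C * f' (pt (x, y)))).
have -> : complex.Im ('i%C * f' (pt (x, y))) = complex.Re (f' (pt (x, y))).
  by case: (f' _) => a b; simpc.
rewrite /comp /= => H; refine (cvg_trans _ H).
apply: near_eq_cvg; near=> h; rewrite /pt /=.
have -> : h%:C%C * 'i%C + (x +i* y)%C = (x +i* (h + y))%C by simpc.
case: (f _) => a b; case: (f _) => c d; by simpc.
Unshelve. all: by end_near. Qed.

Lemma entire_continuous_Re : continuous (fun p : R * R => complex.Re (f (pt p))).
Proof.
move=> p; have cf := entire_continuous fe.
have cfp := @cvg_comp _ _ _ _ _ _ _ _ (@continuous_pt p) (cf (pt p)).
exact: (@cvg_comp _ _ _ _ _ _ _ _ cfp (@continuous_Re (f (pt p)))).
Qed.

Lemma entire_continuous_Im : continuous (fun p : R * R => complex.Im (f (pt p))).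
Proof.
move=> p; have cf := entire_continuous fe.
have cfp := @cvg_comp _ _ _ _ _ _ _ _ (@continuous_pt p) (cf (pt p)).
exact: (@cvg_comp _ _ _ _ _ _ _ _ cfp (@continuous_Im (f (pt p)))).
Qed.
End partials.
End complex_to_real.

(** * Borel sets of the plane *)

Section plane_measure.
Context {R : realType}.

(** The plane with the product of the Borel sigma-algebras, which is the
    measurable structure carried by [area_measure]. *)
Definition plane := (measurableTypeR R * measurableTypeR R)%type.

Lemma open_measurable_plane (U : set (R * R)) :
  open U -> measurable (U : set plane).
Proof.
move=> oU.
(* Rational squares contained in U form a countable cover of U. *)
pose B (q : rat * rat * nat) : set (R * R) :=
  ball (ratr q.1.1 : R) q.2.+1%:R^-1 `*` ball (ratr q.1.2 : R) q.2.+1%:R^-1.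
have -> : U = \bigcup_q [set p | B q p /\ B q `<=` U].
  apply/seteqP; split => [[x y] Uxy|p [q _ []]]; last first.
    by move=> ? ; exact.
  have [e /= e0 eU] : nbhs_ball (x, y) U by apply/nbhs_ballP; exact: open_nbhs_nbhs.
  have e2 : 0 < e / 2 by rewrite divr_gt0.
  have [n _ /(_ n (leqnn n)) /= ne] := near_infty_natSinv_lt (PosNum e2).
  pose d := n.+1%:R^-1 : R; have d0 : 0 < d by rewrite invr_gt0.
  have {}ne : d < e / 2 := ne.
  have approx t : exists q : rat, ball (ratr q : R) d t.
    have [|q] := @rat_in_itvoo R (t - d) (t + d); first lra.
    rewrite in_itv /= => /andP[q1 q2]; exists q.
    by rewrite -ball_normE /= ltr_norml; apply/andP; split; lra.
  have [q1 xq1] := approx x; have [q2 yq2] := approx y.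
  exists (q1, q2, n) => //; split=> // -[s t] [/= sq tq]; apply: eU.
  (* The square is centered within d of the point and has radius d, so that
     it stays within 2 d < e of the point. *)
  have close (a b c : R) : ball c d a -> ball c d b -> ball a e b.
    move=> ca cb; apply: (@le_ball _ _ _ (d + d)); first by lra.
    by apply: ball_triangle cb; exact: ball_sym.
  by split; [exact: close xq1 sq|exact: close yq2 tq].
apply: countable_bigcupT_measurable => [|q]; first exact: countableP.
have [BU|nBU] := pselect (B q `<=` U); last first.
  rewrite (_ : [set p | _] = set0)//.
  by apply/seteqP; split=> // p [].
rewrite (_ : [set p | _] = B q); last by apply/seteqP; split=> // p [].
by apply: (@measurableX _ _ (measurableTypeR R) (measurableTypeR R));
  apply: open_measurable; exact: ball_open.
Qed.

Lemma continuous_measurable_plane (f : R * R -> R) :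
  continuous f -> measurable_fun setT (f : plane -> R).
Proof.
move=> cf; apply: (measurability _ (RGenOpens.measurableE R)).
move=> _ [_ [a [b ->] <-]]; rewrite setTI; apply: open_measurable_plane.
by move/continuousP: cf; apply; exact: interval_open.
Qed.
End plane_measure.

(** * Integrals of partial derivatives with compact support *)

Section compact_support.
Context {R : realType}.
Local Notation mu := (@lebesgue_measure R).
Local Notation area := (mu \x mu)%E.

(** The fundamental theorem of calculus on [[-M, M]]: the primitive vanishes at
    both ends and the integrand vanishes outside. *)
Lemma integral_derive_eq0 (F g : R -> R) (M : R) :
  0 < M -> continuous g -> (forall x, is_derive x (1 : R) F (g x)) ->
  (forall x, M <= `|x| -> F x = 0) -> (forall x, M <= `|x| -> g x = 0) ->
  (\int[mu]_x (g x)%:E = 0)%E.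
Proof.
move=> M0 cg dF F0 g0.
have -> : (\int[mu]_x (g x)%:E = \int[mu]_(x in `[(- M)%R, M]) (g x)%:E)%E.
  rewrite [RHS]integral_mkcond; apply: eq_integral => x _.
  rewrite /patch; case: ifPn => //; rewrite notin_setE /= in_itv /= => /negP.
  rewrite -ler_norml -ltNge => Mx; rewrite g0//; exact: ltW.
have cF : continuous F.
  by move=> x; apply: differentiable_continuous; apply/derivable1_diffP.
rewrite (@continuous_FTC2 _ g F); first last.
- by move=> x _; rewrite derive1E; exact: derive_val.
- split.
  + by move=> x _; exact: ex_derive.
  + by apply: cvg_at_right_filter; exact: cF.
  + by apply: cvg_at_left_filter; exact: cF.
- by apply: continuous_subspaceT.
- by rewrite gtrN.
by rewrite !F0 ?subee// ?normrN ger0_norm// ltW.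
Qed.

Lemma continuous_box_bounded {h : R * R -> R} (M : R) : continuous h ->
  exists K, forall p, `|p.1| <= M -> `|p.2| <= M -> `|h p| <= K.
Proof.
move=> ch; pose I : set R := `[- M, M]%classic.
have : compact (h @` (I `*` I)).
  apply: continuous_compact; first exact: continuous_subspaceT.
  by apply: compact_setX; exact: segment_compact.
move=> /compact_bounded[C [_ HC]]; exists (C + 1) => p p1 p2.
apply: (HC (C + 1)); first by rewrite ltrDl.
by exists p => //; split; rewrite /I /= in_itv /= -ler_norml.
Qed.

(** The partial derivatives are carried as data, so that the calculus below
    produces them in closed form. *)
Definition C1 (U Ux Uy : R * R -> R) := [/\ continuous U, continuous Ux,
  continuous Uy, forall x y, is_derive x (1 : R) (fun t => U (t, y)) (Ux (x, y))
  & forall x y, is_derive y (1 : R) (fun t => U (x, t)) (Uy (x, y))].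

Definition supported (M : R) (U : R * R -> R) :=
  forall p, M <= `|p.1| \/ M <= `|p.2| -> U p = 0.

Lemma supported_integrable {M h} : continuous h -> supported M h ->
  area.-integrable setT (EFin \o h).
Proof.
move=> ch hM.
pose I : set R := `[- M, M]%classic; pose B := I `*` I.
have mB : measurable (B : set plane).
  by apply: (@measurableX _ _ (measurableTypeR R) (measurableTypeR R));
    exact: measurable_itv.
have [C hC] := continuous_box_bounded M ch.
apply: (@le_integrable _ plane _ _ _ measurableT _ (EFin \o (fun p => C * \1_B p))).
- by apply/measurable_EFinP; exact: continuous_measurable_plane.
- move=> p _; rewrite /= lee_fin.
  have [pB|pB] := boolP (p \in B).
    rewrite indicE pB mulr1; apply: le_trans (ler_norm _).
    by move/set_mem: pB => -[]; rewrite /I /= !in_itv /= -!ler_norml; exact: hC.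
  suff -> : h p = 0 by rewrite normr0.
  have : ~ (I p.1 /\ I p.2) by move: pB; rewrite notin_setE.
  by move=> /not_andP[] /negP; rewrite /I /= in_itv /= -ler_norml -ltNge => /ltW ?;
    apply: hM; [left|right].
- have -> : EFin \o (fun p => C * \1_B p) = (fun p => (C%:E * (\1_B p)%:E)%E).
    by apply/funext.
  apply: integrableZl => //; apply/integrableP; split.
    by apply/measurable_EFinP; exact: measurable_indic.
  rewrite (eq_integral (fun x : plane => (\1_B x)%:E)); last first.
    by move=> t _; rewrite gee0_abs// lee_fin.
  rewrite integral_indic// setIT.
  rewrite (_ : _ B = (mu I * mu I)%E); last first.
    by apply: product_measure1E; exact: measurable_itv.
  rewrite /I !lebesgue_measure_itv /=.
  by case: ifPn; rewrite ?mule0// -EFinB -EFinM ltry.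
Qed.

(** By Fubini, integrating in the [x] direction first. *)
Lemma integral_partial_x {M U Ux Uy} : 0 < M -> C1 U Ux Uy ->
  supported M U -> supported M Ux -> \int[area]_p Ux p = 0.
Proof.
move=> M0 [cU cUx cUy dx dy] sU sUx; rewrite /Rintegral.
rewrite -integral21_prod_meas1/=; last first.
  exact: supported_integrable sUx.
rewrite /fubini_G integral0_eq// => y _ /=.
apply: (integral_derive_eq0 (fun x => U (x, y)) (fun x => Ux (x, y)) M) => //.
- move=> x; apply: (@continuous_comp _ _ _ (fun x => (x, y)) Ux); last exact: cUx.
  exact: (@cvg_pair _ _ _ _ _ _ _ _ _ _ _ cvg_id (cvg_cst y)).
- by move=> x ?; apply: sU; left.
- by move=> x ?; apply: sUx; left.
Qed.

Lemma integral_partial_y {M U Ux Uy} : 0 < M -> C1 U Ux Uy ->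
  supported M U -> supported M Uy -> \int[area]_p Uy p = 0.
Proof.
move=> M0 [cU cUx cUy dx dy] sU sUy; rewrite /Rintegral.
rewrite -integral12_prod_meas1/=; last first.
  exact: supported_integrable sUy.
rewrite /fubini_F integral0_eq// => x _ /=.
apply: (integral_derive_eq0 (fun y => U (x, y)) (fun y => Uy (x, y)) M) => //.
- move=> y; apply: (@continuous_comp _ _ _ (fun y => (x, y)) Uy); last exact: cUy.
  exact: (@cvg_pair _ _ _ _ _ _ _ _ _ _ _ (cvg_cst x) cvg_id).
- by move=> y ?; apply: sU; right.
- by move=> y ?; apply: sUy; right.
Qed.
End compact_support.

(** * Calculus of continuously differentiable functions *)

Section plane_calculus.
Context {R : realType}.
Implicit Types (f g U V : R * R -> R).

Lemma contD {f g} : continuous f -> continuous g -> continuous (fun p => f p + g p).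
Proof. by move=> cf cg p; apply: cvgD; [exact: cf|exact: cg]. Qed.

Lemma contB {f g} : continuous f -> continuous g -> continuous (fun p => f p - g p).
Proof. by move=> cf cg p; apply: cvgB; [exact: cf|exact: cg]. Qed.

Lemma contM {f g} : continuous f -> continuous g -> continuous (fun p => f p * g p).
Proof. by move=> cf cg p; apply: cvgM; [exact: cf|exact: cg]. Qed.

Lemma contN {f} : continuous f -> continuous (fun p => - f p).
Proof. by move=> cf p; apply: cvgN; exact: cf. Qed.

Lemma cont_cst (c : R) : continuous (fun _ : R * R => c).
Proof. by move=> p; exact: cvg_cst. Qed.

Lemma cont_fst : continuous (fun p : R * R => p.1).
Proof. by move=> p; exact: cvg_fst. Qed.

Lemma cont_snd : continuous (fun p : R * R => p.2).
Proof. by move=> p; exact: cvg_snd. Qed.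

Lemma cont_comp (k : R -> R) f :
  continuous k -> continuous f -> continuous (fun p => k (f p)).
Proof. by move=> ck cf p; apply: (@continuous_comp _ _ _ f k); [exact: cf|exact: ck]. Qed.

Lemma C1_eq U Ux Uy V Vx Vy : C1 U Ux Uy ->
  U =1 V -> Ux =1 Vx -> Uy =1 Vy -> C1 V Vx Vy.
Proof. by move=> CU /funext<- /funext<- /funext<-. Qed.

Lemma C1_cst (c : R) : C1 (fun=> c) (fun=> 0) (fun=> 0).
Proof.
by split; do ?[exact: cont_cst]; move=> x y; exact: is_derive_cst.
Qed.

Lemma C1_fst : C1 (fun p : R * R => p.1) (fun=> 1) (fun=> 0).
Proof.
split; [exact: cont_fst|exact: cont_cst|exact: cont_cst| |] => x y /=.
  exact: is_derive_id.
exact: is_derive_cst.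
Qed.

Lemma C1_snd : C1 (fun p : R * R => p.2) (fun=> 0) (fun=> 1).
Proof.
split; [exact: cont_snd|exact: cont_cst|exact: cont_cst| |] => x y /=.
  exact: is_derive_cst.
exact: is_derive_id.
Qed.

Lemma C1D {U Ux Uy V Vx Vy} : C1 U Ux Uy -> C1 V Vx Vy ->
  C1 (fun p => U p + V p) (fun p => Ux p + Vx p) (fun p => Uy p + Vy p).
Proof.
move=> [? ? ? Ux' Uy'] [? ? ? Vx' Vy']; split; do ?[exact: contD] => x y.
  by have := @is_deriveD _ _ _ _ _ _ _ _ _ (Ux' x y) (Vx' x y).
by have := @is_deriveD _ _ _ _ _ _ _ _ _ (Uy' x y) (Vy' x y).
Qed.

Lemma C1N {U Ux Uy} : C1 U Ux Uy ->
  C1 (fun p => - U p) (fun p => - Ux p) (fun p => - Uy p).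
Proof.
move=> [? ? ? Ux' Uy']; split; do ?[exact: contN] => x y.
  by have := @is_deriveN _ _ _ _ _ _ _ (Ux' x y).
by have := @is_deriveN _ _ _ _ _ _ _ (Uy' x y).
Qed.

Lemma C1M {U Ux Uy V Vx Vy} : C1 U Ux Uy -> C1 V Vx Vy ->
  C1 (fun p => U p * V p) (fun p => Ux p * V p + U p * Vx p)
     (fun p => Uy p * V p + U p * Vy p).
Proof.
move=> [? ? ? Ux' Uy'] [? ? ? Vx' Vy'].
split; do ?[exact: contM|apply: contD] => x y; do ?[exact: contM].
  rewrite addrC [_ * V _]mulrC.
  exact: (@is_deriveM _ _ _ _ _ _ _ _ (Ux' x y) (Vx' x y)).
rewrite addrC [_ * V _]mulrC.
exact: (@is_deriveM _ _ _ _ _ _ _ _ (Uy' x y) (Vy' x y)).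
Qed.

Lemma C1_comp {k dk : R -> R} {U Ux Uy} :
  continuous dk -> (forall t, is_derive t (1 : R) k (dk t)) -> C1 U Ux Uy ->
  C1 (fun p => k (U p)) (fun p => dk (U p) * Ux p) (fun p => dk (U p) * Uy p).
Proof.
move=> cdk kd [? ? ? Ux' Uy'].
have ck : continuous k.
  by move=> t; apply: differentiable_continuous; apply/derivable1_diffP.
split; do ?[exact: cont_comp]; do ?[apply: contM => //; exact: cont_comp].
  move=> x y.
  exact: (@is_derive1_comp _ _ _ _ _ _ (kd _) (Ux' x y)).
move=> x y.
exact: (@is_derive1_comp _ _ _ _ _ _ (kd _) (Uy' x y)).
Qed.

Definition rho (p : R * R) : R := p.1 ^+ 2 + p.2 ^+ 2.

Lemma C1_rho : C1 rho (fun p => 2 * p.1) (fun p => 2 * p.2).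
Proof.
apply: C1_eq (C1D (C1M C1_fst C1_fst)
  (C1M C1_snd C1_snd)) _ _ _ => p; rewrite /rho; ring.
Qed.

Definition gweight (p : R * R) : R := expR (- rho p) / pi.

Lemma gweight_gt0 p : 0 < gweight p.
Proof. by rewrite divr_gt0// ?expR_gt0// pi_gt0. Qed.

(** The square makes the cutoff continuously differentiable; the linear function
    of [t = |z|^2] makes the derivative of size [1 / n], which is why the boundary
    term disappears in the limit. *)
Definition cutoff (n : nat) (t : R) : R := Num.max 0 (1 - t / n.+1%:R) ^+ 2.
Definition dcutoff (n : nat) (t : R) : R :=
  - (2 / n.+1%:R) * Num.max 0 (1 - t / n.+1%:R).

Lemma cutoff_range n t : 0 <= t -> 0 <= cutoff n t <= 1.
Proof.
move=> t0; rewrite sqr_ge0 /=; rewrite exprn_ile1// ?le_max ?lexx//.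
by rewrite ge_max ler01 /= gerBl divr_ge0.
Qed.

Lemma dcutoff_range n t : 0 <= t -> - 2 <= dcutoff n t <= 0.
Proof.
move=> t0; have n0 : 0 < n.+1%:R^-1 :> R by rewrite invr_gt0.
have n1 : n.+1%:R^-1 <= 1 :> R by rewrite invf_le1// ler1n.
have tn0 : 0 <= t * n.+1%:R^-1 by rewrite mulr_ge0// ltW.
rewrite /dcutoff; set m := Num.max _ _.
have m0 : 0 <= m by rewrite le_max lexx.
have m1 : m <= 1 by rewrite ge_max ler01 /= gerBl.
have cm1 : n.+1%:R^-1 * m <= 1 by rewrite mulr_ile1// ltW.
have cm0 : 0 <= n.+1%:R^-1 * m by rewrite mulr_ge0// ltW.
by rewrite mulNr -mulrA lerN2 oppr_le0; move: cm0 cm1; set a := _ * m;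
  move=> *; apply/andP; split; lra.
Qed.

Lemma cutoff_out n t : n.+1%:R <= t -> cutoff n t = 0 /\ dcutoff n t = 0.
Proof.
move=> nt; rewrite /cutoff /dcutoff.
suff -> : Num.max 0 (1 - t / n.+1%:R) = 0 by rewrite expr0n mulr0.
by apply/max_idPl; rewrite subr_le0 ler_pdivlMr// mul1r.
Qed.

Lemma is_derive_cutoff n t : is_derive t (1 : R) (cutoff n) (dcutoff n t).
Proof.
apply: is_derive_cvg; set d := dcutoff n t.
have c0 : 0 < n.+1%:R^-1 :> R by rewrite invr_gt0.
have c1 : n.+1%:R^-1 <= 1 :> R by rewrite invf_le1// ler1n.
apply/cvgrPdist_le => e e0; near=> h.
have h0 : h != 0 by near: h; exact: nbhs_dnbhs_neq.
have he : `|h| <= e by near: h; exact: dnbhs0_le.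
apply: le_trans he.
have -> : d - h^-1 * (cutoff n (h + t) - cutoff n t) =
    h^-1 * (h * d - (cutoff n (h + t) - cutoff n t)).
  by rewrite [RHS]mulrBr mulKf.
rewrite normrM normfV ler_pdivrMl ?normr_gt0// -normrM -expr2.
rewrite [leRHS]ger0_norm ?sqr_ge0//.
rewrite /d /cutoff /dcutoff (mulrDl h t).
move: c0 c1; set c := n.+1%:R^-1 => c0 c1.
have -> : 1 - (h * c + t * c) = (1 - t * c) - h * c by ring.
(* With q s = max 0 s ^ 2, the error q (s + k) - q s - 2 k max 0 s is at most
   k ^ 2 for all s and k, at the kink as well as away from it. *)
have : (h * c) ^+ 2 <= h ^+ 2.
  by rewrite exprMn -[leRHS]mulr1 ler_wpM2l ?sqr_ge0// exprn_ile1// ltW.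
rewrite (_ : h * (- (2 * c) * Num.max 0 (1 - t * c)) =
  - (2 * (h * c) * Num.max 0 (1 - t * c))); last by ring.
set b := h * c; set a := 1 - t * c => bh; apply: le_trans bh.
rewrite !maxEle; case: ifPn; case: ifPn; rewrite -?ltNge => a1 a2;
  by rewrite ler_norml; apply/andP; split; nra.
Unshelve. all: by end_near. Qed.

Lemma continuous_dcutoff n : continuous (dcutoff n).
Proof.
move=> t; apply: cvgMl_tmp.
apply: (@continuous_max _ _ (fun=> 0) (fun t : R => 1 - t / n.+1%:R)).
  exact: cvg_cst.
by apply: cvgB; [exact: cvg_cst|apply: cvgMr_tmp; exact: cvg_id].
Qed.

End plane_calculus.

(** * Gaussian integrals and the divergence theorem *)

Section gaussian_integral.
Context {R : realType}.
Implicit Types (u v U V P Q A B : R * R -> R).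
Local Notation mu := (@lebesgue_measure R).
Local Notation area := (mu \x mu)%E.

Definition gintegrable u : Prop :=
  area.-integrable setT (EFin \o (fun p => u p * gweight p)).

Definition gint u : R := \int[area]_p (u p * gweight p).

Lemma C1_gweight : C1 (@gweight R) (fun p => - (2 * p.1) * gweight p)
  (fun p => - (2 * p.2) * gweight p).
Proof.
have e := C1_comp (@continuous_expR R) (@is_derive_expR R)
  (C1N C1_rho).
apply: C1_eq (C1M e (C1_cst (pi^-1))) _ _ _ => p //=;
  rewrite /gweight; ring.
Qed.

Lemma cont_gweight : continuous (@gweight R).
Proof. by have [] := C1_gweight. Qed.

Definition chi n (p : R * R) := cutoff n (rho p).
Definition dchi n (p : R * R) := dcutoff n (rho p).

Lemma rho_ge0 (p : R * R) : 0 <= rho p.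
Proof. by rewrite addr_ge0 ?sqr_ge0. Qed.

Lemma chi_range n p : 0 <= chi n p <= 1.
Proof. exact/cutoff_range/rho_ge0. Qed.

Lemma dchi_range n p : - 2 <= dchi n p <= 0.
Proof. exact/dcutoff_range/rho_ge0. Qed.

Lemma chi_supported n : supported n.+1%:R (chi n) /\ supported n.+1%:R (dchi n).
Proof.
suff H p : n.+1%:R <= `|p.1| \/ n.+1%:R <= `|p.2| -> chi n p = 0 /\ dchi n p = 0.
  by split=> p /H[].
move=> np; apply: cutoff_out; rewrite /rho.
have n1 : 1 <= n.+1%:R :> R by rewrite ler1n.
have p1 := sqr_ge0 p.1; have p2 := sqr_ge0 p.2.
by case: np => np; have : n.+1%:R ^+ 2 <= `|_| ^+ 2 := lerXn2r 2 _ _ np;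
  rewrite ?nnegrE// real_normK ?num_real//; nra.
Qed.

Lemma C1_chi n :
  C1 (chi n) (fun p => dchi n p * (2 * p.1)) (fun p => dchi n p * (2 * p.2)).
Proof.
exact: (C1_comp (continuous_dcutoff n) (is_derive_cutoff n) C1_rho).
Qed.

Lemma cont_chi n : continuous (chi n).
Proof. by have [] := C1_chi n. Qed.

Lemma cont_dchi n : continuous (dchi n).
Proof.
by apply: cont_comp; [exact: continuous_dcutoff|have [] := @C1_rho R].
Qed.

Lemma supported_gintegrable {M u} : continuous u -> supported M u -> gintegrable u.
Proof.
move=> cu su; apply: (@supported_integrable _ M).
  by apply: contM => //; exact: cont_gweight.
by move=> p pM; rewrite su// mul0r.
Qed.

(** The divergence theorem for the field [(P, Q)] times
    [cutoff n (|z|^2) e^(-|z|^2) / pi]; since the gradient of a function of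
    [|z|^2] is radial, the field enters the last term through [x P + y Q]. *)
Lemma gint_divergence n {P Px Py Q Qx Qy} : C1 P Px Py -> C1 Q Qx Qy ->
  gint (fun p => (Px p + Qy p) * chi n p
    + 2 * (p.1 * P p + p.2 * Q p) * (dchi n p - chi n p)) = 0.
Proof.
move=> CP CQ; have W := C1M (C1_chi n) C1_gweight.
have [sc sd] := chi_supported n.
have n0 : 0 < n.+1%:R :> R by [].
have CPW := C1M CP W; have CQW := C1M CQ W.
have sP : supported n.+1%:R (fun p => P p * (chi n p * gweight p)).
  by move=> p /sc ->; rewrite mul0r mulr0.
have sQ : supported n.+1%:R (fun p => Q p * (chi n p * gweight p)).
  by move=> p /sc ->; rewrite mul0r mulr0.
set Dx := (X in C1 _ X _) in CPW; set Dy := (X in C1 _ _ X) in CQW.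
have sDx : supported n.+1%:R Dx.
  by move=> p pn; rewrite /Dx /= sc// sd// !(mul0r,mulr0,addr0).
have sDy : supported n.+1%:R Dy.
  by move=> p pn; rewrite /Dy /= sc// sd// !(mul0r,mulr0,addr0).
have := integral_partial_y n0 CQW sQ sDy.
have := integral_partial_x n0 CPW sP sDx.
move=> iDx iDy; rewrite -[RHS]addr0 -{1}iDx -iDy -RintegralD//.
- apply: eq_Rintegral => p _; rewrite /Dx /Dy; ring.
- by case: CPW => _ c _ _ _; exact: supported_integrable sDx.
- by case: CQW => _ _ c _ _; exact: supported_integrable sDy.
Qed.

End gaussian_integral.

(** * Removing the cutoff *)

Section gaussian_limits.
Context {R : realType}.
Implicit Types (u v A B : R * R -> R).
Local Notation mu := (@lebesgue_measure R).
Local Notation area := (mu \x mu)%E.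

Lemma gintegrableD {u v} : gintegrable u -> gintegrable v ->
  gintegrable (fun p => u p + v p).
Proof.
move=> iu iv; rewrite /gintegrable.
rewrite (_ : _ \o _ = ((EFin \o (fun p => (u p * gweight p)%R)) \+
  (EFin \o (fun p => (v p * gweight p)%R)))%E); first exact: integrableD.
by apply/funext => p /=; rewrite mulrDl.
Qed.

Lemma gintegrableZ c {u} : gintegrable u -> gintegrable (fun p => c * u p).
Proof.
move=> iu; rewrite /gintegrable.
rewrite (_ : _ \o _ = (fun p => c%:E * (EFin \o (fun p => (u p * gweight p)%R)) p)%E).
  exact: integrableZl.
by apply/funext => p /=; rewrite -mulrA.
Qed.

Lemma gintegrableN u : gintegrable u -> gintegrable (fun p => - u p).
Proof.
move=> /(gintegrableZ (-1)); congr gintegrable.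
by apply/funext => p; rewrite mulN1r.
Qed.

Lemma gintegrableB {u v} : gintegrable u -> gintegrable v ->
  gintegrable (fun p => u p - v p).
Proof. by move=> iu iv; apply: gintegrableD => //; exact: gintegrableN. Qed.

Lemma gintD u v : gintegrable u -> gintegrable v ->
  gint (fun p => u p + v p) = gint u + gint v.
Proof.
move=> iu iv; rewrite /gint -RintegralD//.
by apply: eq_Rintegral => p _; rewrite mulrDl.
Qed.

Lemma gintZ c u : gintegrable u -> gint (fun p => c * u p) = c * gint u.
Proof.
move=> iu; rewrite /gint -RintegralZl//.
by apply: eq_Rintegral => p _; rewrite mulrA.
Qed.

Lemma gintN u : gintegrable u -> gint (fun p => - u p) = - gint u.
Proof.
move=> iu; rewrite -mulN1r -gintZ//.
by apply: eq_Rintegral => p _; rewrite mulN1r.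
Qed.

Lemma gintB u v : gintegrable u -> gintegrable v ->
  gint (fun p => u p - v p) = gint u - gint v.
Proof. by move=> iu iv; rewrite gintD ?gintN//; exact: gintegrableN. Qed.

Lemma eq_gint {u v} : u =1 v -> gint u = gint v.
Proof. by move=> uv; apply: eq_Rintegral => p _; rewrite uv. Qed.

Lemma gint_ge0 u : (forall p, 0 <= u p) -> 0 <= gint u.
Proof. by move=> u0; apply: Rintegral_ge0 => p _; rewrite mulr_ge0// ltW// gweight_gt0. Qed.

Lemma le_gint u v : gintegrable u -> gintegrable v ->
  (forall p, u p <= v p) -> gint u <= gint v.
Proof.
move=> iu iv uv; apply: le_Rintegral => // p _.
by rewrite ler_wpM2r// ltW// gweight_gt0.
Qed.

Lemma measurable_gweight {u} : continuous u ->
  measurable_fun setT (EFin \o (fun p => u p * gweight p) : plane -> \bar R).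
Proof.
move=> cu; apply/measurable_EFinP; apply: continuous_measurable_plane.
by apply: contM => //; exact: cont_gweight.
Qed.

Lemma gintegrable_le {u v} : continuous u -> (forall p, `|u p| <= v p) ->
  gintegrable v -> gintegrable u.
Proof.
move=> cu uv; apply: (@le_integrable _ plane _ _ _ measurableT).
  exact: measurable_gweight.
move=> p _ /=; rewrite lee_fin !normrM ler_wpM2r//.
exact: le_trans (ler_norm _).
Qed.

Lemma inv_cvg0 (t : R) : (fun n : nat => t / n.+1%:R) @ \oo --> (0 : R).
Proof.
by rewrite -[0 in X in _ --> X](mulr0 t); apply: cvgMl_tmp; exact: cvg_harmonic.
Qed.

Lemma cutoff_cvg t : (fun n => cutoff n t : R) @ \oo --> (1 : R).
Proof.
have c : {for 0, continuous (fun s : R => Num.max 0 (1 - s) ^+ 2)}.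
  apply: cvgM; apply: (@continuous_max _ _ (fun=> 0) (fun t : R => 1 - t));
  by [exact: cvg_cst|apply: cvgB; [exact: cvg_cst|exact: cvg_id]].
have := @cvg_comp _ _ _ _ _ _ _ _ (inv_cvg0 t) c.
by rewrite subr0 (max_idPr (ler01 : 0 <= 1 :> R)) expr1n.
Qed.

Lemma dcutoff_cvg t : (fun n => dcutoff n t : R) @ \oo --> (0 : R).
Proof.
have c : {for 0, continuous (fun s : R => Num.max 0 (1 - s))}.
  apply: (@continuous_max _ _ (fun=> 0) (fun t : R => 1 - t));
  by [exact: cvg_cst|apply: cvgB; [exact: cvg_cst|exact: cvg_id]].
have m := @cvg_comp _ _ _ _ _ _ _ _ (inv_cvg0 t) c.
have := cvgM (cvgN (inv_cvg0 2)) m.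
by rewrite oppr0 mul0r; exact.
Qed.

Lemma gint_dominated {u_ : nat -> R * R -> R} {u v} :
  (forall n, continuous (u_ n)) -> continuous u -> gintegrable v ->
  (forall n p, `|u_ n p| <= v p) -> (forall p, u_ ^~ p @ \oo --> u p) ->
  gintegrable u /\ gint (u_ n) @[n --> \oo] --> gint u.
Proof.
move=> cu_ cu iv uv uu.
pose U_ n : plane -> \bar R := EFin \o (fun p => u_ n p * gweight p).
pose U : plane -> \bar R := EFin \o (fun p => u p * gweight p).
pose V : plane -> \bar R := EFin \o (fun p => v p * gweight p).
have U_cvg : {ae area, forall p, [set: plane] p -> U_ n p @[n --> \oo] --> U p}.
  apply: aeW => p _; apply: cvg_EFin; first exact: nearW.
  by apply: cvgMr_tmp; exact: uu.
have U_dom : {ae area, forall p n, [set: plane] p -> (`|U_ n p| <= V p)%E}.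
  apply: aeW => p n _; rewrite /U_ /V /= lee_fin normrM.
  by rewrite (gtr0_norm (gweight_gt0 _)) ler_wpM2r// ltW// gweight_gt0.
have [iu _ cvg] := dominated_convergence measurableT
  (fun n => measurable_gweight (cu_ n)) (measurable_gweight cu) U_cvg iv U_dom.
split=> //; rewrite /gint /Rintegral; apply: fine_cvg.
by rewrite fineK//; exact: integrable_fin_num.
Qed.

(** By dominated convergence: [chi n] tends to [1] and [dchi n] to [0], with
    [|chi n| <= 1] and [|dchi n - chi n| <= 3]. Thus integration by parts against
    the Gaussian leaves no boundary term as soon as both sides are integrable. *)
Lemma gint_limit {A B} : continuous A -> continuous B ->
  gintegrable A -> gintegrable B ->
  (forall n, gint (fun p => A p * chi n p + B p * (dchi n p - chi n p)) = 0) ->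
  gint A = gint B.
Proof.
move=> cA cB iA iB AB0.
have iabs u : continuous u -> gintegrable u -> gintegrable (fun p => `|u p|).
  move=> cu iu; rewrite /gintegrable.
  rewrite (_ : _ \o _ = abse \o (EFin \o (fun p => u p * gweight p))).
    exact: integrable_abse.
  by apply/funext => p /=; rewrite normrM (gtr0_norm (gweight_gt0 _)).
have iv : gintegrable (fun p => `|A p| + 3 * `|B p|).
  by apply: gintegrableD; [|apply: gintegrableZ]; exact: iabs.
pose u_ n p := A p * chi n p + B p * (dchi n p - chi n p).
have cu_ n : continuous (u_ n).
  apply: contD; apply: contM => //; first exact: cont_chi.
  by apply: contB; [exact: cont_dchi|exact: cont_chi].
have uv n p : `|u_ n p| <= `|A p| + 3 * `|B p|.
  have /andP[c0 c1] := chi_range n p; have /andP[d0 d1] := dchi_range n p.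
  rewrite /u_; apply: le_trans (ler_normD _ _) _; rewrite (normrM (A p)) (normrM (B p)).
  apply: lerD.
    by rewrite (ger0_norm c0) ler_piMr.
  rewrite mulrC ler_wpM2r// ler_norml; apply/andP; split; lra.
have u_cvg p : u_ ^~ p @ \oo --> A p - B p.
  rewrite (_ : A p - B p = A p * 1 + B p * (0 - 1)); last by ring.
  apply: cvgD; apply: cvgMl_tmp; first exact: cutoff_cvg.
  by apply: cvgB; [exact: dcutoff_cvg|exact: cutoff_cvg].
have [iAB] := gint_dominated cu_ (contB cA cB) iv uv u_cvg.
rewrite (_ : (fun n => gint (u_ n)) = fun=> 0); last first.
  by apply/funext => n; exact: AB0.
move=> c0; have : gint (fun p => A p - B p) = 0.
  by apply: (@cvg_unique _ (@Rhausdorff R) _ _ _ _ c0); exact: cvg_cst.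
by rewrite gintB// => /subr0_eq.
Qed.

(** By Fatou, uniform bounds on the cut off integrals suffice; this is how
    membership in the Fock space is obtained rather than assumed. *)
Lemma gintegrable_of_bounded {u} C : continuous u -> (forall p, 0 <= u p) ->
  (forall n, gint (fun p => u p * chi n p) <= C) -> gintegrable u.
Proof.
move=> cu u0 uC; apply/integrableP; split; first exact: measurable_gweight.
pose f n : plane -> \bar R := EFin \o (fun p => u p * chi n p * gweight p).
have fm n : measurable_fun setT (f n).
  by apply: measurable_gweight; apply: contM => //; exact: cont_chi.
have f0 n p : [set: plane] p -> (0 <= f n p)%E.
  have /andP[c0 _] := chi_range n p.
  by rewrite /f /= lee_fin (mulr_ge0 (mulr_ge0 (u0 p) c0))// ltW// gweight_gt0.
have iuc n : gintegrable (fun p => u p * chi n p).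
  apply: (@supported_gintegrable _ n.+1%:R).
    by apply: contM => //; exact: cont_chi.
  by move=> p pn; have [-> //] := chi_supported (R := R) n; rewrite mulr0.
have fC n : (\int[area]_p f n p <= C%:E)%E.
  rewrite -[leLHS]fineK ?lee_fin; last exact: (integrable_fin_num _ (iuc n)).
  exact: uC.
have lim_f p : limn_einf (f^~ p) = `|(u p * gweight p)%:E|%E.
  have c : f ^~ p @ \oo --> (u p * 1 * gweight p)%:E.
    apply: cvg_EFin; first exact: nearW.
    by apply: cvgMr_tmp; apply: cvgMl_tmp; exact: cutoff_cvg.
  have [-> _] := cvg_limn_einf_sup c.
  by rewrite mulr1 gee0_abs// lee_fin mulr_ge0// ltW// gweight_gt0.
rewrite (_ : integral _ _ _ =
    (\int[area]_(p in [set: plane]) limn_einf (f^~ p))%E); last first.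
  by apply: eq_integral => p _; rewrite lim_f.
apply: le_lt_trans (fatou _ measurableT fm f0) _.
apply: le_lt_trans (ltry C).
rewrite limn_einf_lim; apply: lime_le; first exact: is_cvg_einfs.
apply: nearW => n; apply: le_trans (fC n).
by apply: ereal_inf_lbound; exists n => /=.
Qed.
End gaussian_limits.

(** * Integral identities for a holomorphic function *)

Section holomorphic_identities.
Context {R : realType}.
Context {u v a b : R * R -> R}.
Hypothesis Cu : C1 u a (fun p => - b p).
Hypothesis Cv : C1 v b a.

(** Here [f = u + i v] and [f' = a + i b], and the Cauchy-Riemann equations are
    [Cu] and [Cv]; below, [F = |f|^2], [G = |f'|^2], and [E] is the Euler
    derivative of [F]. *)
Let F p := u p ^+ 2 + v p ^+ 2.
Let G p := a p ^+ 2 + b p ^+ 2.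
Let Fx p := 2 * (u p * a p + v p * b p).
Let Fy p := 2 * (v p * a p - u p * b p).
Let E p := p.1 * Fx p + p.2 * Fy p.

Hypothesis iF : gintegrable F.
Hypothesis iG : gintegrable G.

(** The gradient of [|f|^2], by the Cauchy-Riemann equations. *)
Lemma C1_sqmod : C1 F Fx Fy.
Proof.
by apply: C1_eq (C1D (C1M Cu Cu) (C1M Cv Cv)) _ _ _ => p;
  rewrite /F /Fx /Fy; ring.
Qed.

Let cF : continuous F. Proof. by case: C1_sqmod. Qed.
Let cFx : continuous Fx. Proof. by case: C1_sqmod. Qed.
Let cFy : continuous Fy. Proof. by case: C1_sqmod. Qed.
Let ca : continuous a. Proof. by case: Cu. Qed.
Let cb : continuous b. Proof. by case: Cv. Qed.
Let crho : continuous (@rho R). Proof. by case: (@C1_rho R). Qed.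
Let crF : continuous (fun p => rho p * F p). Proof. exact: contM. Qed.
Let cE : continuous E.
Proof.
by apply: contD; apply: contM => //; [exact: cont_fst|exact: cont_snd].
Qed.
Let cG : continuous G. Proof. by apply: contD; apply: contM. Qed.

Let F_ge0 p : 0 <= F p. Proof. by rewrite addr_ge0 ?sqr_ge0. Qed.
Let G_ge0 p : 0 <= G p. Proof. by rewrite addr_ge0 ?sqr_ge0. Qed.

(** As [E = 2 Re (z f' conj f)], this is [2 x y <= x^2 + y^2] for the absolute
    values of [z f] and [f']. *)
Lemma euler_bound p : `|E p| <= rho p * F p + G p.
Proof.
case: p => x y; rewrite /E /Fx /Fy /F /G /rho /=.
set A := u _; set B := v _; set C := a _; set D := b _.
(* The squares of |conj(z) f + f'| and |conj(z) f - f'|. *)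
have pos := addr_ge0 (sqr_ge0 (x * A + y * B + C)) (sqr_ge0 (x * B - y * A + D)).
have neg := addr_ge0 (sqr_ge0 (x * A + y * B - C)) (sqr_ge0 (x * B - y * A - D)).
by rewrite ler_norml; apply/andP; split; lra.
Qed.

(** The divergence theorem for the radial field [|f|^2 (x, y)], whose divergence
    is [2 |f|^2 + E]. *)
Lemma euler_cutoff n :
  gint (fun p => (2 * F p + E p) * chi n p
    + 2 * (rho p * F p) * (dchi n p - chi n p)) = 0.
Proof.
have := gint_divergence n
  (C1M C1_fst C1_sqmod) (C1M C1_snd C1_sqmod).
by rewrite -[RHS]/0 => <-; apply: eq_gint => p; rewrite /E /rho; ring.
Qed.

(** If [f] and [f'] are square integrable, so is [z f]: in the cut off Euler
    identity the term [dchi] has a favourable sign, and half of the term in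
    [|z f|^2] absorbs [E]. *)
Lemma gintegrable_rho_sqmod : gintegrable (fun p => rho p * F p).
Proof.
pose C := 2 * gint F + gint G.
have sup n (w : R * R -> R) : continuous w -> gintegrable (fun p => w p * chi n p).
  move=> cw; apply: (@supported_gintegrable _ n.+1%:R).
    by apply: contM => //; exact: cont_chi.
  by move=> p pn; have [-> //] := chi_supported (R := R) n; rewrite mulr0.
have supd n (w : R * R -> R) : continuous w -> gintegrable (fun p => w p * dchi n p).
  move=> cw; apply: (@supported_gintegrable _ n.+1%:R).
    by apply: contM => //; exact: cont_dchi.
  by move=> p pn; have [_ -> //] := chi_supported (R := R) n; rewrite mulr0.
have c2FG : continuous (fun p => 2 * F p + G p).
  by apply: contD => //; apply: contM => //; exact: cont_cst.
apply: (gintegrable_of_bounded C crF).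
  by move=> p; rewrite mulr_ge0// rho_ge0.
move=> n; have := euler_cutoff n => e0.
have i2FG : gintegrable (fun p => 2 * F p + G p).
  by apply: gintegrableD => //; exact: gintegrableZ.
apply: (@le_trans _ _ (gint (fun p => (2 * F p + G p) * chi n p))).
  rewrite -subr_ge0 -gintB; [|exact: sup|exact: sup].
  rewrite -e0; apply: le_gint.
  - apply: gintegrableD.
      apply: (sup n (fun p => 2 * F p + E p)).
      by apply: contD => //; apply: contM => //; exact: cont_cst.
    have c2 : continuous (fun p => 2 * (rho p * F p)).
      by apply: contM => //; exact: cont_cst.
    have := gintegrableB (supd n _ c2) (sup n _ c2).
    by congr gintegrable; apply/funext => p; ring.
  - by apply: gintegrableB; exact: sup.
  - move=> p; have /andP[c0 c1] := chi_range n p.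
    have /andP[d0 d1] := dchi_range n p.
    have := euler_bound p; rewrite ler_norml => /andP[_ Ep].
    have rF : 0 <= rho p * F p by rewrite mulr_ge0// rho_ge0.
    have : E p * chi n p <= (rho p * F p + G p) * chi n p by rewrite ler_wpM2r.
    have : (rho p * F p) * dchi n p <= 0 by rewrite mulr_ge0_le0.
    by move: (E p) (rho p * F p) (F p) (G p) (chi n p) (dchi n p) => *; lra.
rewrite /C -gintZ// -gintD//; last exact: gintegrableZ.
apply: le_gint => //; first exact: sup.
move=> p; have /andP[c0 c1] := chi_range n p.
by rewrite ler_piMr// addr_ge0// mulr_ge0.
Qed.

Let iE : gintegrable E.
Proof.
apply: (gintegrable_le cE euler_bound).
by apply: gintegrableD => //; exact: gintegrable_rho_sqmod.
Qed.

Lemma gint_euler : 2 * gint F + gint E = 2 * gint (fun p => rho p * F p).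
Proof.
rewrite -!gintZ// -?gintD//; [|exact: gintegrableZ|exact: gintegrable_rho_sqmod].
apply: gint_limit euler_cutoff.
- by apply: contD => //; apply: contM => //; exact: cont_cst.
- by apply: contM => //; exact: cont_cst.
- by apply: gintegrableD => //; exact: gintegrableZ.
- by apply: gintegrableZ; exact: gintegrable_rho_sqmod.
Qed.

Lemma gintegrable_coord_sqmod (w : R * R -> R) : continuous w ->
  (forall p, w p ^+ 2 <= rho p) -> gintegrable (fun p => w p * F p).
Proof.
move=> cw wr; apply: (@gintegrable_le _ _ (fun p => F p + rho p * F p)).
- exact: contM.
- move=> p; rewrite normrM (ger0_norm (F_ge0 p)) -[X in _ <= X + _]mul1r -mulrDl.
  rewrite ler_wpM2r//; have := wr p; rewrite -(real_normK (num_real (w p))).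
  by have := sqr_ge0 (`|w p| - 1); have := sqr_ge0 `|w p|; lra.
by apply: gintegrableD => //; exact: gintegrable_rho_sqmod.
Qed.

(** Together with [gint_gradient_y], this is the adjunction [<f', f> = <f, z f>]: the
    divergence theorem for the fields [|f|^2 (1, 0)] and [|f|^2 (0, 1)]. *)
Lemma gint_gradient_x : gint Fx = 2 * gint (fun p => p.1 * F p).
Proof.
have i1 : gintegrable (fun p => p.1 * F p).
  apply: gintegrable_coord_sqmod => [|p]; first exact: cont_fst.
  by rewrite lerDl sqr_ge0.
rewrite -gintZ//; apply: gint_limit => //.
- by apply: contM; [exact: cont_cst|apply: contM => //; exact: cont_fst].
- apply: (@gintegrable_le _ _ (fun p => F p + G p)) => //; last exact: gintegrableD.
  move=> p; rewrite /Fx /F /G; move: (u p) (v p) (a p) (b p) => A B C D.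
  rewrite ler_norml; apply/andP; split.
    have := addr_ge0 (sqr_ge0 (A + C)) (sqr_ge0 (B + D)); lra.
  have := addr_ge0 (sqr_ge0 (A - C)) (sqr_ge0 (B - D)); lra.
- exact: gintegrableZ.
- move=> n; have := gint_divergence n C1_sqmod (C1_cst 0).
  by rewrite -[RHS]/0 => <-; apply: eq_gint => p; ring.
Qed.

Lemma gint_gradient_y : gint Fy = 2 * gint (fun p => p.2 * F p).
Proof.
have i2 : gintegrable (fun p => p.2 * F p).
  apply: gintegrable_coord_sqmod => [|p]; first exact: cont_snd.
  by rewrite lerDr sqr_ge0.
rewrite -gintZ//; apply: gint_limit => //.
- by apply: contM; [exact: cont_cst|apply: contM => //; exact: cont_snd].
- apply: (@gintegrable_le _ _ (fun p => F p + G p)) => //; last exact: gintegrableD.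
  move=> p; rewrite /Fy /F /G; move: (u p) (v p) (a p) (b p) => A B C D.
  rewrite ler_norml; apply/andP; split.
    have := addr_ge0 (sqr_ge0 (B + C)) (sqr_ge0 (A - D)); lra.
  have := addr_ge0 (sqr_ge0 (B - C)) (sqr_ge0 (A + D)); lra.
- exact: gintegrableZ.
- move=> n; have := gint_divergence n (C1_cst 0) C1_sqmod.
  by rewrite -[RHS]/0 => <-; apply: eq_gint => p; ring.
Qed.

Section difference_quotient.

Lemma C1_shift {U Ux Uy} (h : R) : C1 U Ux Uy ->
  C1 (fun p => U (p.1 + h, p.2)) (fun p => Ux (p.1 + h, p.2))
     (fun p => Uy (p.1 + h, p.2)).
Proof.
move=> [cU cUx cUy dx dy].
have cs W : continuous W -> continuous (fun p : R * R => W (p.1 + h, p.2) : R).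
  move=> cW p; apply: (@continuous_comp _ _ _ (fun p : R * R => (p.1 + h, p.2)) W).
    exact: (@cvg_pair _ _ _ _ _ _ _ _ _ _ _
      (cvgD (@cvg_fst _ _ (nbhs p.1) (nbhs p.2) _) (cvg_cst h)) cvg_snd).
  exact: cW.
split; do ?[exact: cs] => x y /=; last exact: dy.
have := @is_derive1_comp _ (fun t => U (t, y)) (fun t => t + h) x _ _ (dx (x + h) y)
  (@is_deriveD _ _ _ _ _ _ _ _ _ (is_derive_id x 1) (is_derive_cst h x 1)).
by rewrite addr0 mulr1.
Qed.

(** The field [f conj f'] has divergence [2 |f'|^2], but its partial derivatives
    involve [f''], whose continuity is not known. The difference quotient
    [n (f (z + 1/n) - f z)] is again holomorphic and continuously differentiable,
    and it takes the place of [f'] until the limit is taken. *)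
Let d (U : R * R -> R) n p := (U (p.1 + n.+1%:R^-1, p.2) - U p) * n.+1%:R.

Lemma C1_quotient {U Ux Uy} n : C1 U Ux Uy -> C1 (d U n) (d Ux n) (d Uy n).
Proof.
move=> CU; apply: C1_eq (C1M (C1D (C1_shift (n.+1%:R^-1) CU)
  (C1N CU)) (C1_cst n.+1%:R)) _ _ _ => p; rewrite /d; ring.
Qed.

Lemma quotient_cvg {U Ux Uy} p : C1 U Ux Uy -> d U ^~ p @ \oo --> Ux p.
Proof.
case: p => x y [_ _ _ dx _]; have [dU vU] := dx x y.
have cs := (cvgr_dnbhsP _ _ _).1 dU (fun n => n.+1%:R^-1).
rewrite -[lim _]/('D_1 (fun t => U (t, y)) x) vU in cs.
refine (cvg_trans _ (cs _)).
  apply: near_eq_cvg; apply: nearW => n; rewrite /d /= invrK /shift /=.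
  by rewrite /GRing.scale /= mulr1 mulrC (addrC x).
by split; [move=> n; rewrite invr_eq0|exact: cvg_harmonic].
Qed.

Lemma quotient_bound {U Ux Uy} n p K : C1 U Ux Uy ->
  (forall t, p.1 <= t <= p.1 + 1 -> `|Ux (t, p.2)| <= K) -> `|d U n p| <= K.
Proof.
case: p => x y [_ _ _ dx _] /= UK; rewrite /d /=.
set h := n.+1%:R^-1; have h0 : 0 < h by rewrite invr_gt0.
have h1 : h <= 1 by rewrite invf_le1// ler1n.
have xh : x < x + h by rewrite ltrDl.
have cU : {within `[x, x + h], continuous (fun t => U (t, y))}.
  apply: continuous_subspaceT => t; apply: differentiable_continuous.
  by apply/derivable1_diffP; have [] := dx t y.
have [c] := MVT xh (fun t _ => dx t y) cU.
rewrite in_itv /= => /andP[xc ch] ->.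
rewrite -addrA [h - _]addrC addrA subrr add0r.
rewrite -mulrA mulVf// mulr1; apply: UK.
by rewrite (ltW xc) /=; lra.
Qed.

(** The divergence theorem for the field [f conj D], where [D] is the difference
    quotient: as [conj D] is antiholomorphic, derivatives of [D] cancel in the
    divergence, which is [2 Re (f' conj D)]. *)
Lemma quotient_cutoff N n :
  gint (fun p => 2 * (a p * d u n p + b p * d v n p) * chi N p
    + 2 * (p.1 * (u p * d u n p + v p * d v n p) +
           p.2 * (v p * d u n p - u p * d v n p)) * (dchi N p - chi N p)) = 0.
Proof.
have Du := C1_quotient n Cu; have Dv := C1_quotient n Cv.
have P := C1D (C1M Cu Du) (C1M Cv Dv).
have Q := C1D (C1M Cv Du) (C1N (C1M Cu Dv)).
have := gint_divergence N P Q.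
by rewrite -[RHS]/0 => <-; apply: eq_gint => p; rewrite /d; ring.
Qed.

(** The limit of [quotient_cutoff] at a fixed cutoff, where the mean value theorem
    bounds the difference quotients uniformly on the support. *)
Lemma gint_dbar_cutoff N :
  gint (fun p => 2 * G p * chi N p + E p * (dchi N p - chi N p)) = 0.
Proof.
have [Ka aK] := continuous_box_bounded (N.+1%:R + 1) ca.
have [Kb bK] := continuous_box_bounded (N.+1%:R + 1) cb.
(* The cutoff is m ^ 2 and its derivative is - (2 / (N + 1)) m, so that both are
   controlled by the continuous compactly supported function m. *)
pose m (p : R * R) : R := Num.max 0 (1 - rho p / N.+1%:R).
have cm : continuous m.
  move=> p; apply: (@continuous_max _ _ (fun=> 0) (fun p => 1 - rho p / N.+1%:R)).
    exact: cvg_cst.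
  by apply: cvgB; [exact: cvg_cst|apply: cvgMr_tmp; exact: crho].
have m0 p : 0 <= m p by rewrite le_max lexx.
have m1 p : m p <= 1 by rewrite ge_max ler01 /= gerBl divr_ge0// rho_ge0.
have sm : supported N.+1%:R m.
  move=> p /(chi_supported N).1; rewrite /chi /cutoff -/(m p) => /eqP.
  by rewrite sqrf_eq0 => /eqP.
pose K := `|Ka| + `|Kb|.
pose V p := (2 * ((`|a p| + `|b p|) * K) +
  6 * ((`|p.1| + `|p.2|) * ((`|u p| + `|v p|) * K))) * m p.
pose u_ n p := 2 * (a p * d u n p + b p * d v n p) * chi N p
    + 2 * (p.1 * (u p * d u n p + v p * d v n p) +
           p.2 * (v p * d u n p + - u p * d v n p)) * (dchi N p - chi N p).
have lin (al be s t L : R) : `|s| <= L -> `|t| <= L ->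
    `|al * s + be * t| <= (`|al| + `|be|) * L.
  move=> sL tL; apply: le_trans (ler_normD _ _) _; rewrite !normrM mulrDl.
  by apply: lerD; rewrite ler_wpM2l.
have cu : continuous u by case: Cu.
have cv : continuous v by case: Cv.
have cn (w : R * R -> R) : continuous w -> continuous (fun p => `|w p|).
  by move=> cw p; apply: cvg_norm; exact: cw.
have iV : gintegrable V.
  apply: (@supported_gintegrable _ N.+1%:R); last first.
    by move=> p pN; rewrite /V sm// mulr0.
  have cK := cont_cst K.
  apply: contM => //; apply: contD; apply: contM; try exact: cont_cst.
    by apply: contM => //; apply: contD; exact: cn.
  apply: contM; first by apply: contD; apply: cn; [exact: cont_fst|exact: cont_snd].
  by apply: contM => //; apply: contD; exact: cn.
have uV n p : `|u_ n p| <= V p.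
  have chiE : chi N p = m p ^+ 2 by [].
  have dchiE : dchi N p = - (2 / N.+1%:R) * m p by [].
  have [p1|p1] := leP N.+1%:R `|p.1|.
    by rewrite /u_ /V chiE dchiE sm ?expr0n ?(mulr0,subr0,addr0,normr0)//; left.
  have [p2|p2] := leP N.+1%:R `|p.2|.
    by rewrite /u_ /V chiE dchiE sm ?expr0n ?(mulr0,subr0,addr0,normr0)//; right.
  (* The mean value point lies at distance at most 1 from p. *)
  have near_p t : p.1 <= t <= p.1 + 1 -> `|t| <= N.+1%:R + 1.
    move: p1; rewrite ltr_norml => /andP[? ?] /andP[? ?].
    by rewrite ler_norml; apply/andP; split; lra.
  have p2' : `|p.2| <= N.+1%:R + 1 by rewrite ltW// (lt_trans p2)// ltrDl.
  have duK : `|d u n p| <= K.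
    apply: le_trans (_ : Ka <= _); last first.
      by apply: le_trans (ler_norm _) _; rewrite lerDl.
    by apply: quotient_bound Cu _ => t /near_p tN; exact: (aK (t, p.2)).
  have dvK : `|d v n p| <= K.
    apply: le_trans (_ : Kb <= _); last first.
      by apply: le_trans (ler_norm _) _; rewrite lerDr.
    by apply: quotient_bound Cv _ => t /near_p tN; exact: (bK (t, p.2)).
  rewrite /u_ /V [leRHS]mulrDl.
  have S1 := lin (a p) (b p) _ _ _ duK dvK.
  have Su := lin (u p) (v p) _ _ _ duK dvK.
  have Sv := lin (v p) (- u p) _ _ _ duK dvK.
  rewrite normrN [`|v p| + _]addrC in Sv.
  have S2 := lin p.1 p.2 _ _ _ Su Sv.
  have N0 : 0 <= N.+1%:R^-1 :> R by rewrite invr_ge0.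
  have N1 : N.+1%:R^-1 <= 1 :> R by rewrite invf_le1// ler1n.
  have Nm : N.+1%:R^-1 * m p <= m p by rewrite ler_piMl.
  have Nm0 : 0 <= N.+1%:R^-1 * m p by rewrite mulr_ge0.
  have mm : m p ^+ 2 <= m p by rewrite expr2 ler_piMr.
  have chim : `|chi N p| <= m p by rewrite chiE ger0_norm ?sqr_ge0.
  have dchim : `|dchi N p - chi N p| <= 3 * m p.
    rewrite chiE dchiE ler_norml mulNr -mulrA; have := sqr_ge0 (m p).
    move: mm Nm Nm0 (m0 p); move: (N.+1%:R^-1) (m p) => c t *.
    by apply/andP; split; lra.
  apply: le_trans (ler_normD _ _) _; apply: lerD.
    rewrite (normrM _ (chi N p)) normrM normr_nat.
    by apply: ler_pM; rewrite ?mulr_ge0// ler_wpM2l.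
  rewrite (normrM _ (dchi N p - _)) normrM normr_nat.
  rewrite (_ : 6 * _ * m p = (2 * ((`|p.1| + `|p.2|) * ((`|u p| + `|v p|) * K)))
    * (3 * m p)); last by ring.
  by apply: ler_pM; rewrite ?mulr_ge0// ler_wpM2l.
have Cd n : C1 _ _ _ := C1_quotient n Cu.
have Ce n : C1 _ _ _ := C1_quotient n Cv.
have cu_ n : continuous (u_ n).
  have cd : continuous (d u n) by have [] := Cd n.
  have ce : continuous (d v n) by have [] := Ce n.
  have cc := cont_chi (R := R) N; have cdc := cont_dchi (R := R) N.
  have [c1 c2] := (@cont_fst R, @cont_snd R); have c22 := cont_cst (2 : R).
  have cNu := contN cu; have cb1 := contB cdc cc.
  apply: contD; apply: contM => //; apply: contM => //; apply: contD;
    apply: contM => //.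
    by apply: contD; exact: contM.
  by apply: contD; exact: contM.
have cl : continuous (fun p => 2 * G p * chi N p + E p * (dchi N p - chi N p)).
  apply: contD; apply: contM => //.
  - by apply: contM => //; exact: cont_cst.
  - exact: cont_chi.
  - by apply: contB; [exact: cont_dchi|exact: cont_chi].
have u_cvg p : u_ ^~ p @ \oo -->
    2 * G p * chi N p + E p * (dchi N p - chi N p).
  have da := quotient_cvg p Cu; have db := quotient_cvg p Cv.
  rewrite (_ : 2 * G p * chi N p + E p * (dchi N p - chi N p) =
    2 * (a p * a p + b p * b p) * chi N p
    + 2 * (p.1 * (u p * a p + v p * b p) +
           p.2 * (v p * a p + - u p * b p)) * (dchi N p - chi N p)); last first.
    by rewrite /G /E /Fx /Fy; ring.
  apply: cvgD; apply: cvgMr_tmp; apply: cvgMl_tmp; apply: cvgD;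
    apply: cvgMl_tmp => //; apply: cvgD; exact: cvgMl_tmp.
have [_] := gint_dominated cu_ cl iV uV u_cvg.
rewrite (_ : (fun n => gint (u_ n)) = fun=> 0); last first.
  apply/funext => n; rewrite -(quotient_cutoff N n); apply: eq_gint => p.
  by rewrite /u_ mulNr.
move=> c0; apply: (@cvg_unique _ (@Rhausdorff R) _ _ _ _ c0); exact: cvg_cst.
Qed.

End difference_quotient.

Lemma gint_dbar : 2 * gint G = gint E.
Proof.
rewrite -gintZ//; apply: (gint_limit _ _ _ _ gint_dbar_cutoff) => //.
  by apply: contM => //; exact: cont_cst.
exact: gintegrableZ.
Qed.

(** The norm form of the commutation relation [(z f)' - z f' = f]: the Euler
    identity gives [|z f|^2 = |f|^2 + Re <z f', f>], and [gint_dbar] identifies the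
    last term with [|f'|^2]. *)
Lemma gint_commutator : gint (fun p => rho p * F p) = gint F + gint G.
Proof. by have := gint_euler; have := gint_dbar; lra. Qed.

End holomorphic_identities.

(** * The Hermitian product *)

Section fock_inner_product.
Context {R : realType}.
Implicit Types (f g h : R[i] -> R[i]) (c : R[i]) (w : R[i] -> R).
Local Notation normc := ComplexField.Normc.normc.

Lemma cont_ext {u v : R * R -> R} : continuous u -> u =1 v -> continuous v.
Proof. by move=> cu /funext <-. Qed.

Lemma gauss_weightedE w : gauss_weighted w = (fun p => w (pt p) * gweight p).
Proof.
by apply/funext => p; rewrite /gauss_weighted /gweight (normc_sqr (pt p)).
Qed.

Lemma lambda_intE w : lambda_int w = gint (w \o pt).
Proof. by rewrite /lambda_int gauss_weightedE. Qed.

Lemma lambda_integrableE w : lambda_integrable w = gintegrable (w \o pt).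
Proof. by rewrite /lambda_integrable gauss_weightedE. Qed.

(** A common home for [f], [f'], [z f] and their combinations: only continuity is
    kept from holomorphy, and it suffices for measurability and for definiteness
    of the norm. *)
Definition square_integrable g :=
  [/\ continuous (fun p : R * R => complex.Re (g (pt p))),
      continuous (fun p : R * R => complex.Im (g (pt p))) &
      lambda_integrable (fun z => normc (g z) ^+ 2)].

Lemma in_fock_square_integrable {f} : in_fock f -> square_integrable f.
Proof.
by move=> [ef intf]; split=> //; [exact: entire_continuous_Re|exact: entire_continuous_Im].
Qed.

Lemma square_integrableD {g h} : square_integrable g -> square_integrable h ->
  square_integrable (g \+ h).
Proof.
move=> [cg1 cg2]; rewrite lambda_integrableE => ig.
move=> [ch1 ch2]; rewrite lambda_integrableE => ih.
have c1 := contD cg1 ch1; have c2 := contD cg2 ch2.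
have E1 p : complex.Re (g (pt p) + h (pt p)) = complex.Re (g (pt p)) + complex.Re (h (pt p)).
  by case: (g _) => ? ?; case: (h _).
have E2 p : complex.Im (g (pt p) + h (pt p)) = complex.Im (g (pt p)) + complex.Im (h (pt p)).
  by case: (g _) => ? ?; case: (h _).
split.
- by apply: (cont_ext c1) => p; rewrite /= E1.
- by apply: (cont_ext c2) => p; rewrite /= E2.
rewrite lambda_integrableE.
have i2 := gintegrableZ 2 (gintegrableD ig ih).
apply: gintegrable_le i2.
  have c : continuous (fun p => (complex.Re (g (pt p)) + complex.Re (h (pt p))) ^+ 2 +
     (complex.Im (g (pt p)) + complex.Im (h (pt p))) ^+ 2).
    by apply: contD; apply: contM.
  by apply: (cont_ext c) => p; rewrite /= normc_sqr E1 E2.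
move=> p; rewrite ger0_norm ?sqr_ge0//= !normc_sqr E1 E2.
move: (complex.Re _) (complex.Im _) (complex.Re _) (complex.Im _) => x y s t.
by have := addr_ge0 (sqr_ge0 (x - s)) (sqr_ge0 (y - t)); lra.
Qed.

Lemma square_integrableZ c {g} : square_integrable g ->
  square_integrable (fun z => c * g z).
Proof.
move=> [cg1 cg2]; rewrite lambda_integrableE => ig.
have E1 z : complex.Re (c * g z) =
   complex.Re c * complex.Re (g z) - complex.Im c * complex.Im (g z).
  by case: (c) => ? ?; case: (g _).
have E2 z : complex.Im (c * g z) =
   complex.Re c * complex.Im (g z) + complex.Im c * complex.Re (g z).
  by case: (c) => ? ?; case: (g _).
have k x := cont_cst (x : R).
split.
- have c1 := contB (contM (k (complex.Re c)) cg1) (contM (k (complex.Im c)) cg2).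
  by apply: (cont_ext c1) => p; rewrite /= E1.
- have c1 := contD (contM (k (complex.Re c)) cg2) (contM (k (complex.Im c)) cg1).
  by apply: (cont_ext c1) => p; rewrite /= E2.
rewrite lambda_integrableE; have := gintegrableZ (normc c ^+ 2) ig.
by congr gintegrable; apply/funext => p; rewrite /= !normc_sqr E1 E2; ring.
Qed.

Lemma square_integrableB {g h} : square_integrable g -> square_integrable h ->
  square_integrable (g \- h).
Proof.
move=> ig /(square_integrableZ (-1)) /(square_integrableD ig).
by congr square_integrable; apply/funext => z /=; rewrite mulN1r.
Qed.

Lemma re_dotE f g z : complex.Re (f z * conjc (g z)) =
  complex.Re (f z) * complex.Re (g z) + complex.Im (f z) * complex.Im (g z).
Proof. by case: (f z) => a b; case: (g z) => c d; simpc. Qed.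

Lemma im_dotE f g z : complex.Im (f z * conjc (g z)) =
  complex.Im (f z) * complex.Re (g z) - complex.Re (f z) * complex.Im (g z).
Proof. by case: (f z) => a b; case: (g z) => c d; simpc; rewrite /= addrC. Qed.

Lemma gintegrable_re_dot {f g} : square_integrable f -> square_integrable g ->
  gintegrable ((fun z => complex.Re (f z * conjc (g z))) \o pt).
Proof.
move=> [cf1 cf2]; rewrite lambda_integrableE => jf.
move=> [cg1 cg2]; rewrite lambda_integrableE => jg.
apply: gintegrable_le (gintegrableD jf jg).
  have c := contD (contM cf1 cg1) (contM cf2 cg2).
  by apply: (cont_ext c) => p; rewrite /= re_dotE.
move=> p /=; rewrite re_dotE !normc_sqr.
move: (complex.Re _) (complex.Im _) (complex.Re _) (complex.Im _) => x y s t.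
rewrite ler_norml; apply/andP; split.
  have := addr_ge0 (sqr_ge0 (x + s)) (sqr_ge0 (y + t)).
  by have := addr_ge0 (sqr_ge0 x) (sqr_ge0 y); have := addr_ge0 (sqr_ge0 s) (sqr_ge0 t); lra.
have := addr_ge0 (sqr_ge0 (x - s)) (sqr_ge0 (y - t)).
by have := addr_ge0 (sqr_ge0 x) (sqr_ge0 y); have := addr_ge0 (sqr_ge0 s) (sqr_ge0 t); lra.
Qed.

Lemma gintegrable_im_dot {f g} : square_integrable f -> square_integrable g ->
  gintegrable ((fun z => complex.Im (f z * conjc (g z))) \o pt).
Proof.
move=> sf sg; have := gintegrable_re_dot (square_integrableZ (- 'i%C) sf) sg.
congr gintegrable; apply/funext => p /=.
by case: (f _) => a b; case: (g _) => c d; simpc; rewrite /=; ring.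
Qed.

Lemma fock_dotDl f g h : square_integrable f -> square_integrable g ->
  square_integrable h -> fock_dot (f \+ g) h = fock_dot f h + fock_dot g h.
Proof.
move=> sf sg sh; rewrite /fock_dot !lambda_intE; simpc.
rewrite -!gintD; try exact: gintegrable_re_dot; try exact: gintegrable_im_dot.
by congr Complex; apply: eq_gint => p /=;
  case: (f _) => a b; case: (g _) => c d; case: (h _) => s t; simpc; rewrite /=; ring.
Qed.

Lemma fock_dotZl c f h : square_integrable f -> square_integrable h ->
  fock_dot (fun z => c * f z) h = c * fock_dot f h.
Proof.
move=> sf sh; rewrite /fock_dot !lambda_intE; case: c => c1 c2; simpc.
have ir := gintegrable_re_dot sf sh; have ii := gintegrable_im_dot sf sh.
rewrite -!gintZ// -gintB -?gintD; try exact: gintegrableZ.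
by congr Complex; apply: eq_gint => p /=;
  case: (f _) => a b; case: (h _) => s t; simpc; rewrite /=; ring.
Qed.

Lemma fock_dotC {f g} : square_integrable f -> square_integrable g ->
  fock_dot g f = conjc (fock_dot f g).
Proof.
move=> sf sg; rewrite /fock_dot !lambda_intE /=.
rewrite -gintN; last exact: gintegrable_im_dot.
by congr Complex; apply: eq_gint => p /=;
  case: (f _) => a b; case: (g _) => c d; simpc; rewrite /=; ring.
Qed.

Lemma fock_norm_ge0 f : 0 <= fock_norm f.
Proof. exact: sqrtr_ge0. Qed.

Lemma sqr_fock_norm f : fock_norm f ^+ 2 = gint (fun p => normc (f (pt p)) ^+ 2).
Proof.
rewrite /fock_norm lambda_intE sqr_sqrtr//; apply: gint_ge0 => p.
exact: sqr_ge0.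
Qed.

Lemma fock_dotff {f} : square_integrable f -> fock_dot f f = (fock_norm f ^+ 2)%:C%C.
Proof.
move=> sf; rewrite sqr_fock_norm /fock_dot !lambda_intE; congr Complex.
  by apply: eq_gint => p /=; rewrite re_dotE normc_sqr; ring.
rewrite (@eq_gint _ _ (fun p => 0 * normc (f (pt p)) ^+ 2)).
  by case: sf => _ _; rewrite lambda_integrableE => jf; rewrite gintZ ?mul0r.
by move=> p /=; rewrite im_dotE; ring.
Qed.

End fock_inner_product.

(** * Orthogonal components and angles *)

Section fock_geometry.
Context {R : realType}.
Implicit Types (f g h : R[i] -> R[i]).
Local Notation normc := ComplexField.Normc.normc.
Local Notation mu := (@lebesgue_measure R).
Local Notation area := (mu \x mu)%E.

(** A continuous function that is not zero at a point stays away from zero on a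
    square around it, which has positive area. *)
Lemma fock_norm_eq0 {g} : square_integrable g -> fock_norm g = 0 ->
  forall z, g z = 0.
Proof.
move=> [cg1 cg2]; rewrite lambda_integrableE => jg n0.
pose F p := normc (g (pt p)) ^+ 2 * gweight p.
have cF : continuous F.
  apply: contM; last exact: cont_gweight.
  apply: (@cont_ext _ (fun p => complex.Re (g (pt p)) ^+ 2 + complex.Im (g (pt p)) ^+ 2)).
    by apply: contD; exact: contM.
  by move=> p; rewrite normc_sqr.
have F0 p : 0 <= F p by rewrite mulr_ge0 ?sqr_ge0// ltW// gweight_gt0.
have intF : (\int[area]_p (F p)%:E = 0)%E.
  have : gint (fun p => normc (g (pt p)) ^+ 2) = 0 by rewrite -sqr_fock_norm n0 expr0n.
  rewrite /gint /Rintegral => fine0.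
  by rewrite -[LHS]fineK ?fine0//; exact: (integrable_fin_num measurableT jg).
suff Fz p : F p = 0.
  case=> x y; have /eqP := Fz (x, y).
  rewrite mulf_eq0 (gt_eqF (gweight_gt0 _)) orbF sqrf_eq0 => /eqP.
  exact: ComplexField.Normc.eq0_normc.
apply/eqP; rewrite eq_le F0 andbT leNgt; apply/negP => Fp.
pose d := F p / 2; have d0 : 0 < d by rewrite divr_gt0.
have /nbhs_ballP[r /= r0 rF] : \forall q \near p, d < F q.
  have := cF p => /cvgr_gt; apply; rewrite /d; lra.
pose B := ball p.1 r `*` ball p.2 r.
have mB : measurable (B : set plane).
  by apply: (@measurableX _ _ (measurableTypeR R) (measurableTypeR R));
    apply: open_measurable; exact: ball_open.
have areaB : (area B = ((r *+ 2) * (r *+ 2))%:E)%E.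
  rewrite (_ : area B = mu (ball p.1 r) * mu (ball p.2 r))%E; last first.
    by apply: product_measure1E; apply: open_measurable; exact: ball_open.
  by rewrite !lebesgue_measure_ball ?ltW.
have mF : measurable_fun setT (EFin \o F : plane -> \bar R).
  by apply/measurable_EFinP; apply: continuous_measurable_plane.
suff : (0 < \int[area]_p (F p)%:E)%E by rewrite intF ltxx.
apply: (@lt_le_trans _ _ (\int[area]_(p in B) d%:E)%E).
  rewrite integral_cst// -[X in (_ * X)%E]/(area B) areaB -EFinM lte_fin.
  have r2 : 0 < r *+ 2 by rewrite pmulrn_lgt0.
  exact: mulr_gt0 d0 (mulr_gt0 r2 r2).
apply: (@le_trans _ _ (\int[area]_(p in B) (F p)%:E)%E).
  apply: ge0_le_integral => //.
  - by move=> q _; rewrite lee_fin ltW.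
  - exact: measurable_funS mF.
  - by move=> q [q1 q2]; rewrite lee_fin ltW//; apply: rF.
by apply: ge0_subset_integral => // q _; rewrite lee_fin.
Qed.

Lemma fock_dotDr f g h : square_integrable f -> square_integrable g ->
  square_integrable h -> fock_dot h (f \+ g) = fock_dot h f + fock_dot h g.
Proof.
move=> sf sg sh; have sfg := square_integrableD sf sg.
by rewrite (fock_dotC sfg sh) (@fock_dotC _ f h)// (@fock_dotC _ g h)// fock_dotDl// rmorphD.
Qed.

Lemma fock_dotZr c f h : square_integrable f -> square_integrable h ->
  fock_dot h (fun z => c * f z) = conjc c * fock_dot h f.
Proof.
move=> sf sh; have scf := square_integrableZ c sf.
by rewrite (fock_dotC scf sh) (@fock_dotC _ f h)// fock_dotZl// rmorphM.
Qed.

(** The component of [h] orthogonal to the unit vector [f]. *)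
Definition fock_reject f h : R[i] -> R[i] := fun z => h z - fock_dot h f * f z.

Section unit_vector.
Context {f : R[i] -> R[i]}.
Hypotheses (sf : square_integrable f) (f1 : fock_norm f = 1).

Lemma square_integrable_reject {h} : square_integrable h ->
  square_integrable (fock_reject f h).
Proof. by move=> sh; apply: square_integrableB => //; exact: square_integrableZ. Qed.

Lemma fock_dot_reject {h k} : square_integrable h -> square_integrable k ->
  fock_dot (fock_reject f h) (fock_reject f k) =
  fock_dot h k - fock_dot h f * conjc (fock_dot k f).
Proof.
move=> sh sk.
have E l : square_integrable l -> fock_reject f l = l \+ (fun z => - fock_dot l f * f z).
  by move=> sl; apply/funext => z; rewrite /fock_reject /= mulNr.
have sZ c := square_integrableZ c sf.
have sk' := square_integrableD sk (sZ (- fock_dot k f)).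
rewrite (E h)// (E k)//.
rewrite fock_dotDl// !fock_dotDr// !fock_dotZl// !fock_dotZr// fock_dotff// f1 expr1n.
rewrite -(fock_dotC sk sf) (rmorphN (@conjc R)) /=; ring.
Qed.

Lemma fock_norm_reject {h} : square_integrable h ->
  fock_norm (fock_reject f h) ^+ 2 = fock_norm h ^+ 2 - normc (fock_dot h f) ^+ 2.
Proof.
move=> sh; have := fock_dot_reject sh sh.
rewrite !fock_dotff//; last exact: square_integrable_reject.
case: (fock_dot h f) => a b; rewrite normc_sqr /=; simpc => -[-> _]; ring.
Qed.

(** Pythagoras; when [h] vanishes both sides are zero, whatever the angle. *)
Lemma fock_norm_sin_angle h : square_integrable h ->
  fock_norm h * sin (fock_angle f h) = fock_norm (fock_reject f h).
Proof.
move=> sh; have := fock_norm_reject sh; have h0 := fock_norm_ge0 h.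
have r0 := fock_norm_ge0 (fock_reject f h).
rewrite /fock_angle f1 mulr1; set al := normc _ => nE.
have al0 : 0 <= al by exact: sqrtr_ge0.
have [hz|hz] := eqVneq (fock_norm h) 0.
  rewrite hz mul0r; apply/esym/eqP; rewrite -sqrf_eq0 eq_le sqr_ge0 andbT nE hz.
  by rewrite expr0n sub0r oppr_le0 sqr_ge0.
have hp : 0 < fock_norm h by rewrite lt_neqAle eq_sym hz.
have alh : al <= fock_norm h.
  by rewrite -(@ler_pXn2r _ 2)// -subr_ge0 -nE sqr_ge0.
rewrite sin_acos; last first.
  rewrite ler_pdivrMr// mul1r alh andbT (@le_trans _ _ 0)// ?lerN10//.
  exact: divr_ge0.
have q1 : (al / fock_norm h) ^+ 2 <= 1.
  by rewrite exprn_ile1 ?divr_ge0// ler_pdivrMr// mul1r.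
apply/eqP; rewrite -(@eqrXn2 _ 2) ?mulr_ge0 ?sqrtr_ge0// nE exprMn.
by rewrite (@sqr_sqrtr _ (1 - _)) ?subr_ge0// mulrBr mulr1 expr_div_n mulrCA mulfV ?mulr1// sqrf_eq0.
Qed.

End unit_vector.
End fock_geometry.

(** * Cauchy-Schwarz and its equality case *)

Section cauchy_schwarz.
Context {R : realType}.
Context {u v : R[i] -> R[i]}.
Hypothesis su : square_integrable u.
Hypothesis sv : square_integrable v.

Lemma sqr_fock_norm_lincomb (s t : R) :
  fock_norm ((fun z => s%:C%C * u z) \+ (fun z => t%:C%C * v z)) ^+ 2 =
  s ^+ 2 * fock_norm u ^+ 2 + 2 * (s * t) * complex.Re (fock_dot u v)
  + t ^+ 2 * fock_norm v ^+ 2.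
Proof.
have ssu := square_integrableZ s%:C%C su.
have stv := square_integrableZ t%:C%C sv.
have sw := square_integrableD ssu stv.
have := fock_dotff sw.
rewrite fock_dotDl// !fock_dotDr// !fock_dotZl// !fock_dotZr//.
rewrite (fock_dotC su sv) !fock_dotff//.
case: (fock_dot u v) => a b /=; simpc => -[<- _]; ring.
Qed.

Hypothesis uv1 : complex.Re (fock_dot u v) = -1.

(** A vector of norm zero is the zero function, and would make the inner product zero. *)
Lemma fock_norm_mul_neq0 : fock_norm u != 0 /\ fock_norm v != 0.
Proof.
have E (g : R[i] -> R[i]) : square_integrable g -> fock_norm g = 0 ->
      g = (fun z => 0 * g z).
  by move=> sg g0; apply/funext => z; rewrite (fock_norm_eq0 sg g0) mulr0.
split; apply: contra_eq_neq uv1 => n0.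
  by rewrite (E u su n0) fock_dotZl// mul0r /= eq_sym oppr_eq0 oner_eq0.
by rewrite (E v sv n0) fock_dotZr// conjc0 mul0r /= eq_sym oppr_eq0 oner_eq0.
Qed.

(** The square of the norm of [|v| u + |u| v] is
    [2 |u| |v| (|u| |v| - 1)]. *)
Lemma fock_norm_mul_ge1 : 1 <= fock_norm u * fock_norm v.
Proof.
have [nu nv] := fock_norm_mul_neq0.
have := sqr_fock_norm_lincomb (fock_norm v) (fock_norm u); rewrite uv1.
have u0 := fock_norm_ge0 u; have v0 := fock_norm_ge0 v.
have p0 : 0 < fock_norm u * fock_norm v.
  by rewrite lt_neqAle eq_sym mulf_neq0// mulr_ge0.
move: (fock_norm (_ \+ _)) => w wE; have := sqr_ge0 w; rewrite wE.
rewrite (_ : _ + _ = 2 * (fock_norm u * fock_norm v)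
  * (fock_norm u * fock_norm v - 1)); last by ring.
by rewrite pmulr_rge0 ?subr_ge0// mulr_gt0.
Qed.

(** The combination [|v| u + |u| v] vanishes exactly in the case of equality, which
    makes [|u| / |v|] the constant [c]. *)
Lemma fock_norm_mul_eq1 : fock_norm u * fock_norm v = 1 <->
  exists2 c : R, 0 < c & forall z, u z = - (real_complex R c * v z).
Proof.
have [nu nv] := fock_norm_mul_neq0.
have u0 := fock_norm_ge0 u; have v0 := fock_norm_ge0 v.
have vp : 0 < fock_norm v by rewrite lt_neqAle eq_sym nv.
have up : 0 < fock_norm u by rewrite lt_neqAle eq_sym nu.
split=> [n1|[c c0 uE]].
  exists (fock_norm u / fock_norm v); first exact: divr_gt0.
  set w := (fun z => (fock_norm v)%:C%C * u z) \+ (fun z => (fock_norm u)%:C%C * v z).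
  have sw : square_integrable w.
    by apply: square_integrableD; exact: square_integrableZ.
  have w0 : fock_norm w = 0.
    apply/eqP; rewrite -sqrf_eq0 sqr_fock_norm_lincomb uv1.
    by rewrite [fock_norm v * _]mulrC -!exprMn [fock_norm v * _]mulrC n1; apply/eqP; ring.
  move=> z; have := fock_norm_eq0 sw w0 z; rewrite /w /= => /eqP.
  rewrite addr_eq0 => /eqP wz.
  have nvC : (fock_norm v)%:C%C != 0 :> R[i] by rewrite fmorph_eq0.
  apply: (mulfI nvC); rewrite wz mulrN mulrA -rmorphM /=.
  by rewrite mulrCA mulfV// mulr1.
have := sqr_fock_norm_lincomb 1 c; rewrite uv1.
set w := _ \+ _; have -> : fock_norm w = 0.
  have -> : w = (fun z => 0 * v z).
    by apply/funext => z; rewrite /w /= mul1r uE addNr mul0r.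
  have s0 := square_integrableZ 0 sv.
  have := fock_dotff s0; rewrite fock_dotZl// mul0r => -[/esym/eqP].
  by rewrite sqrf_eq0 => /eqP.
have uE2 : fock_dot u v = (- (c * fock_norm v ^+ 2))%:C%C.
  have -> : u = (fun z => (- c)%:C%C * v z).
    by apply/funext => z; rewrite uE rmorphN mulNr.
  by rewrite fock_dotZl// fock_dotff// -rmorphM mulNr.
have c1 : c * fock_norm v ^+ 2 = 1.
  by move: uv1; rewrite uE2 /= => /eqP; rewrite eqr_opp => /eqP.
move=> e0; have e1 : fock_norm u ^+ 2 = c.
  have : c ^+ 2 * fock_norm v ^+ 2 = c by rewrite expr2 -mulrA c1 mulr1.
  by move: e0; rewrite expr0n /= => e0 e2; lra.
by apply/eqP; rewrite -(@eqrXn2 _ 2) ?mulr_ge0// exprMn e1 c1 expr1n.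
Qed.
End cauchy_schwarz.


(** * The commutation relation *)

Section commutation.
Context {R : realType}.
Context {f : R[i] -> R[i]}.
Hypotheses (f_fock : in_fock f) (f'_fock : in_fock (cderiv f)).
Local Notation normc := ComplexField.Normc.normc.

Let u p := complex.Re (f (pt p)).
Let v p := complex.Im (f (pt p)).
Let a p := complex.Re (cderiv f (pt p)).
Let b p := complex.Im (cderiv f (pt p)).

Let sf := in_fock_square_integrable f_fock.
Let sf' := in_fock_square_integrable f'_fock.

Let Cu : C1 u a (fun p => - b p).
Proof.
have [fe _] := f_fock; case: sf => cu cv _; case: sf' => ca cb _.
by split=> //; [exact: contN|exact: entire_is_derive_Rex|exact: entire_is_derive_Rey].
Qed.

Let Cv : C1 v b a.
Proof.
have [fe _] := f_fock; case: sf => cu cv _; case: sf' => ca cb _.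
by split=> //; [exact: entire_is_derive_Imx|exact: entire_is_derive_Imy].
Qed.

Let iF : gintegrable (fun p => u p ^+ 2 + v p ^+ 2).
Proof.
case: sf => _ _; rewrite lambda_integrableE; congr gintegrable.
by apply/funext => p; rewrite /= normc_sqr.
Qed.

Let iG : gintegrable (fun p => a p ^+ 2 + b p ^+ 2).
Proof.
case: sf' => _ _; rewrite lambda_integrableE; congr gintegrable.
by apply/funext => p; rewrite /= normc_sqr.
Qed.

Lemma square_integrable_zmul : square_integrable (zmul f).
Proof.
case: sf => cu cv _; split.
- apply: (cont_ext (contB (contM cont_fst cu) (contM cont_snd cv))).
  by move=> p; rewrite /zmul /pt; case: (f _).
- apply: (cont_ext (contD (contM cont_fst cv) (contM cont_snd cu))).
  by move=> p; rewrite /zmul /pt; case: (f _).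
rewrite lambda_integrableE; have := gintegrable_rho_sqmod Cu Cv iF iG.
congr gintegrable; apply/funext => p; rewrite /= /zmul /u /v /pt normc_sqr.
by case: (f _) => s t; rewrite /rho /=; ring.
Qed.

(** Twice [f' conj f] is the conjugate of the gradient of [|f|^2], so that this
    instance of the adjunction is [gint_gradient_x] and [gint_gradient_y] put together. *)
Lemma fock_dot_cderiv : fock_dot (cderiv f) f = conjc (fock_dot (zmul f) f).
Proof.
have Fx := gint_gradient_x Cu Cv iF iG; have Fy := gint_gradient_y Cu Cv iF iG.
rewrite /fock_dot !lambda_intE /=; congr Complex.
  have := gintegrable_re_dot sf' sf => j.
  have {}Fx : 2 * gint ((fun z => complex.Re (cderiv f z * conjc (f z))) \o pt) =
      2 * gint (fun p => p.1 * (u p ^+ 2 + v p ^+ 2)).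
    rewrite -Fx -gintZ//; apply: eq_gint => p.
    by rewrite /= re_dotE /u /v /a /b; ring.
  rewrite [RHS](@eq_gint _ _ (fun p => p.1 * (u p ^+ 2 + v p ^+ 2))); first by lra.
  by move=> p; rewrite /= /zmul /u /v /pt; case: (f _) => s t; simpc; rewrite /=; ring.
have := gintegrable_im_dot sf' sf => j.
have {}Fy : - 2 * gint ((fun z => complex.Im (cderiv f z * conjc (f z))) \o pt) =
    2 * gint (fun p => p.2 * (u p ^+ 2 + v p ^+ 2)).
  rewrite -Fy -gintZ//; apply: eq_gint => p.
  by rewrite /= im_dotE /u /v /a /b; ring.
rewrite [X in - X](@eq_gint _ _ (fun p => p.2 * (u p ^+ 2 + v p ^+ 2))); first by lra.
by move=> p; rewrite /= /zmul /u /v /pt; case: (f _) => s t; simpc; rewrite /=; ring.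
Qed.

Lemma sqr_fock_norm_zmul :
  fock_norm (zmul f) ^+ 2 = fock_norm f ^+ 2 + fock_norm (cderiv f) ^+ 2.
Proof.
have := gint_commutator Cu Cv iF iG; rewrite !sqr_fock_norm => E.
rewrite (@eq_gint _ _ (fun p => rho p * (u p ^+ 2 + v p ^+ 2))).
  by rewrite E; congr (_ + _); apply: eq_gint => p; rewrite normc_sqr.
move=> p; rewrite /zmul normc_sqr /u /v /pt.
by case: (f _) => s t; rewrite /rho /=; ring.
Qed.

End commutation.

(** * The uncertainty inequality *)

Section uncertainty.
Context {R : realType}.
Context {f : R[i] -> R[i]}.
Hypotheses (f_fock : in_fock f) (f_unit : fock_norm f = 1).
Hypothesis f'_fock : in_fock (cderiv f).

Let sf := in_fock_square_integrable f_fock.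
Let sf' := in_fock_square_integrable f'_fock.
Let sz := square_integrable_zmul f_fock f'_fock.

Lemma square_integrable_dplus : square_integrable (dplus f).
Proof. exact: square_integrableD. Qed.

Lemma square_integrable_dminus : square_integrable (dminus f).
Proof. exact: square_integrableB. Qed.

Let sp := square_integrable_dplus.
Let sm := square_integrable_dminus.

Let dminusE : dminus f = cderiv f \+ (fun z => -1 * zmul f z).
Proof. by apply/funext => z; rewrite /dminus /= mulN1r. Qed.

(** By adjointness [<f' + z f, f>] is real and [<f' - z f, f>] is imaginary, so
    removing the components along [f] does not change the real part of the
    product, which is [|f'|^2 - |z f|^2 = -1]. *)
Lemma re_fock_dot_reject :
  complex.Re (fock_dot (fock_reject f (dplus f)) (fock_reject f (dminus f))) = -1.
Proof.
rewrite fock_dot_reject// dminusE /dplus.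
have sNz := square_integrableZ (-1) sz.
have sm' := square_integrableD sf' sNz.
rewrite !fock_dotDl// !fock_dotDr// !fock_dotZl// !fock_dotZr//.
rewrite (fock_dotC sf' sz) !fock_dotff// (fock_dot_cderiv f_fock f'_fock).
have := sqr_fock_norm_zmul f_fock f'_fock; rewrite f_unit expr1n => ->.
case: (fock_dot (cderiv f) (zmul f)) => a b; case: (fock_dot (zmul f) f) => s t.
by simpc; rewrite /=; ring.
Qed.

Lemma sqr_fock_norm_parallelogram :
  fock_norm (dplus f) ^+ 2 + fock_norm (dminus f) ^+ 2 =
  2 * (fock_norm (cderiv f) ^+ 2 + fock_norm (zmul f) ^+ 2).
Proof.
have P := sqr_fock_norm_lincomb sf' sz 1 1.
have M := sqr_fock_norm_lincomb sf' sz 1 (-1).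
rewrite (_ : _ \+ _ = dplus f) in P; last first.
  by apply/funext => z; rewrite /dplus /= !mul1r.
rewrite (_ : _ \+ _ = dminus f) in M; last first.
  by apply/funext => z; rewrite /dminus /= mul1r rmorphN mulN1r.
by rewrite P M; ring.
Qed.

Let X := fock_norm (dplus f).
Let Y := fock_norm (dminus f).
Let S := `| sin (fock_angle f (dplus f)) * sin (fock_angle f (dminus f)) |.

Lemma norm_mul_sin : X * Y * S =
  fock_norm (fock_reject f (dplus f)) * fock_norm (fock_reject f (dminus f)).
Proof.
rewrite -!(fock_norm_sin_angle sf f_unit)//.
have X0 : 0 <= X := fock_norm_ge0 _; have Y0 : 0 <= Y := fock_norm_ge0 _.
rewrite -[X in X * _ * _]ger0_norm// -[X in _ * X * _]ger0_norm// /S -!normrM.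
rewrite mulrACA ger0_norm// !fock_norm_sin_angle//.
by rewrite mulr_ge0// fock_norm_ge0.
Qed.

(** The left-hand side exceeds the product of the norms of the orthogonal
    components by [(sigma X - Y)^2 S / (2 sigma)], which vanishes only if
    [Y = sigma X], since that product being at least [1] forces [S > 0]. *)
Lemma uncertainty_bound (sigma : R) : 0 < sigma ->
  let lhs := (sigma / 2 * X ^+ 2 + 1 / (2 * sigma) * Y ^+ 2) * S in
  1 <= lhs /\ (lhs = 1 <-> Y = sigma * X /\ exists2 c : R, 0 < c & intdiff_eq f c).
Proof.
move=> s0 lhs.
have su := square_integrable_reject sf sp.
have sv := square_integrable_reject sf sm.
have ge1 := fock_norm_mul_ge1 su sv re_fock_dot_reject.
have eq1 := fock_norm_mul_eq1 su sv re_fock_dot_reject.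
rewrite -norm_mul_sin in ge1 eq1.
have lhsE : lhs = (sigma * X - Y) ^+ 2 / (2 * sigma) * S + X * Y * S.
  by rewrite /lhs; field; rewrite gt_eqF.
have S0 : 0 <= S by exact: normr_ge0.
have q0 : 0 <= (sigma * X - Y) ^+ 2 / (2 * sigma) * S.
  by rewrite mulr_ge0// divr_ge0 ?sqr_ge0// mulr_ge0// ltW.
split; first by rewrite lhsE; lra.
split=> [l1|[Ys /eq1 e1]]; last first.
  by rewrite lhsE e1 Ys subrr expr0n !mul0r add0r.
have q1 : (sigma * X - Y) ^+ 2 / (2 * sigma) * S = 0 by lra.
split; last by apply/eq1; lra.
have Sn0 : S != 0.
  by apply: contraTneq ge1 => ->; rewrite mulr0 -ltNge ltr01.
have s2 : 0 < 2 * sigma by rewrite mulr_gt0.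
move/eqP: q1; rewrite mulf_eq0 (negbTE Sn0) orbF mulf_eq0 invr_eq0 (gt_eqF s2).
by rewrite orbF sqrf_eq0 subr_eq0 => /eqP.
Qed.
End uncertainty.

Theorem corollary9 (R : realType) (f : R[i] -> R[i])
    (f_fock : in_fock f) (f_unit : fock_norm f = 1) :
  let sin_sin := `| sin (fock_angle f (dplus f)) * sin (fock_angle f (dminus f)) | in
  (forall sigma : R, 0 < sigma ->
     let lhs := fock_lhs f
       ((sigma / 2 * fock_norm (dplus f) ^+ 2
         + 1 / (2 * sigma) * fock_norm (dminus f) ^+ 2) * sin_sin) in
     (1%:E <= lhs)%E /\
     (lhs = 1%:E <->
        [/\ in_fock (cderiv f),
            fock_norm (dminus f) = sigma * fock_norm (dplus f)
          & exists2 c : R, 0 < c & intdiff_eq f c])) /\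
  (let lhs := fock_lhs f
       ((fock_norm (cderiv f) ^+ 2 + fock_norm (zmul f) ^+ 2) * sin_sin) in
   (1%:E <= lhs)%E /\
   (lhs = 1%:E <->
      [/\ in_fock (cderiv f),
          fock_norm (dplus f) = fock_norm (dminus f)
        & exists2 c : R, 0 < c & intdiff_eq f c])).
Proof.
move=> sin_sin.
have [f'_fock|nf'] := pselect (in_fock (cderiv f)); last first.
  have lhs_oo x : fock_lhs f x = +oo%E by rewrite /fock_lhs; case: asboolP.
  by split=> [sigma _|]; rewrite /= !lhs_oo leey; split=> //; split=> // -[].
have lhs_fin x : fock_lhs f x = x%:E by rewrite /fock_lhs; case: asboolP.
have bound := uncertainty_bound f_fock f_unit f'_fock.
split=> [sigma s0|]; rewrite /= lhs_fin lee_fin.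
  have [ge1 [eqr eql]] := bound sigma s0.
  by split=> //; split=> [[/eqr[]]|[_ Ys cE]] //; congr EFin; exact: eql.
have [ge1 eq1] := bound 1 ltr01; move: ge1 eq1; rewrite -/sin_sin.
rewrite !mulr1 div1r -mulrDr (sqr_fock_norm_parallelogram f_fock f'_fock).
rewrite mulKf ?pnatr_eq0// mul1r => ge1 [eqr eql].
split=> //; split=> [[/eqr[-> cE]]|[_ XY cE]] //.
by congr EFin; apply: eql.
Qed.
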